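(* Suppose that Assumption (A) (stated in the context) holds and let $\{(x^k,z^k,y^k)\}_{k\ge0}$ be a sequence generated by Algorithm 1 or Algorithm 2, which is assumed to be bounded. If the regularized augmented Lagrangian $\mathcal{F}_r$ (defined in the context) is a Kurdyka–Łojasiewicz function, then: (i) the sequence $\{(x^k,z^k,y^k)\}_{k\ge0}$ has finite length, namely $$\sum_{k\ge0}\|x^{k+1}-x^k\|<+\infty,\qquad\sum_{k\ge0}\|z^{k+1}-z^k\|<+\infty,\qquad\sum_{k\ge0}\|y^{k+1}-y^k\|<+\infty;$$ (ii) the sequence $\{(x^k,z^k,y^k)\}_{k\ge0}$ converges to a KKT point of the optimization problem $\min_{x\in\mathbb{R}^n}\{g(Ax)+h(x)\}$.
   Context: Setting. All spaces $\mathbb{R}^N$ carry the Euclidean inner product $\langle\cdot,\cdot\rangle$ and norm $\|\cdot\|$; matrices carry the operator norm. $g\colon\mathbb{R}^m\to\mathbb{R}\cup\{+\infty\}$ is proper and lower semicontinuous, $h\colon\mathbb{R}^n\to\mathbb{R}$ is Fréchet differentiable with $L$-Lipschitz continuous gradient, $A\colon\mathbb{R}^n\to\mathbb{R}^m$ is linear with adjoint $A^*$. For a symmetric matrix $M$ put $\|x\|_M^2:=\langle Mx,x\rangle$; $M\succcurlyeq M'$ means $\|x\|_M^2\ge\|x\|_{M'}^2$ for all $x$; $\mathrm{Id}$ is the identity matrix; $\lambda_{\min}$ denotes the smallest eigenvalue. The augmented Lagrangian is $\mathcal{L}_r(x,z,y)=g(z)+h(x)+\langle y,Ax-z\rangle+\frac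 r2\|Ax-z\|^2$ on $\mathbb{R}^n\times\mathbb{R}^m\times\mathbb{R}^m$. Subdifferential. For $\Psi\colon\mathbb{R}^N\to\mathbb{R}\cup\{+\infty\}$ proper lower semicontinuous and $x$ with $\Psi(x)<+\infty$, the Fréchet subdifferential is $\widehat\partial\Psi(x)=\{d:\liminf_{y\to x}\frac{\Psi(y)-\Psi(x)-\langle d,y-x\rangle}{\|y-x\|}\ge0\}$, and the limiting subdifferential $\partial\Psi(x)$ is the set of $d$ for which there are $x^k\to x$, $d^k\to d$ with $\Psi(x^k)\to\Psi(x)$ and $d^k\in\widehat\partial\Psi(x^k)$ for all $k$; both are empty where $\Psi=+\infty$. $\mathrm{dist}(x,\Omega)=\inf_{y\in\Omega}\|x-y\|$. A KKT point of $\min_x\{g(Ax)+h(x)\}$ is a triple $(\widehat x,\widehat z,\widehat y)\in\mathbb{R}^n\times\mathbb{R}^m\times\mathbb{R}^m$ with $-A^*\widehat y=\nabla h(\widehat x)$, $\widehat y\in\partial g(\widehat z)$, $\widehat z=A\widehat x$. Kurdyka–Łojasiewicz (KŁ) functions. For $\eta\in(0,+\infty]$ let $\Phi_\eta$ be the set of concave continuous $\varphi\colon[0,\eta)\to[0,+\infty)$ with $\varphi(0)=0$, $\varphi$ of class $C^1$ on $(0,\eta)$ and continuous at $0$, and $\varphi'(s)>0$ for all $s\in(0,\eta)$. A proper lower semicontinuous $\Psi$ has the KŁ property at $\widehat u$ with $\partial\Psi(\widehat u)\ne\emptyset$ if there exist $\eta\in(0,+\infty]$, a neighborhood $U$ of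 $\widehat u$ and $\varphi\in\Phi_\eta$ such that $\varphi'(\Psi(u)-\Psi(\widehat u))\cdot\mathrm{dist}(0,\partial\Psi(u))\ge1$ for every $u\in U$ with $\Psi(\widehat u)<\Psi(u)<\Psi(\widehat u)+\eta$. $\Psi$ is a KŁ function if it has the KŁ property at each point of $\{u:\partial\Psi(u)\ne\emptyset\}$. Algorithms. Let $\{\mathbf{M}_1^k\}_{k\ge0}\subseteq\mathbb{R}^{n\times n}$, $\{\mathbf{M}_2^k\}_{k\ge0}\subseteq\mathbb{R}^{m\times m}$ be sequences of symmetric positive semidefinite matrices, $r>0$, $0<\rho<2$, and $(x^0,z^0,y^0)\in\mathbb{R}^n\times\mathbb{R}^m\times\mathbb{R}^m$. Both algorithms generate, for every $k\ge0$, $$z^{k+1}\in\arg\min_{z\in\mathbb{R}^m}\Big\{g(z)+\langle y^k,Ax^k-z\rangle+\tfrac r2\|Ax^k-z\|^2+\tfrac12\|z-z^k\|_{\mathbf{M}_2^k}^2\Big\},$$ then $x^{k+1}$, then $y^{k+1}:=y^k+\rho r(Ax^{k+1}-z^{k+1})$, where in Algorithm 1 $$x^{k+1}\in\arg\min_{x\in\mathbb{R}^n}\Big\{h(x)+\langle y^k,Ax-z^{k+1}\rangle+\tfrac r2\|Ax-z^{k+1}\|^2+\tfrac12\|x-x^k\|_{\mathbf{M}_1^k}^2\Big\},$$ and in Algorithm 2 $$x^{k+1}\in\arg\min_{x\in\mathbb{R}^n}\Big\{\langle x-x^k,\nabla h(x^k)\rangle+\langle y^k,Ax-z^{k+1}\rangle+\tfrac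 r2\|Ax-z^{k+1}\|^2+\tfrac12\|x-x^k\|_{\mathbf{M}_1^k}^2\Big\}.$$ Assumption (A). (i) $g$ and $h$ are bounded from below; (ii) $A$ is surjective, and we set $T_0:=\frac{1}{\lambda_{\min}(AA^* )\rho}$ if $0<\rho\le1$, $T_0:=\frac{\rho}{\lambda_{\min}(AA^* )(2-\rho)^2}$ if $1<\rho<2$; (iii) $\mu_1:=\sup_{k\ge0}\|\mathbf{M}_1^k\|<+\infty$ and $\mu_2:=\sup_{k\ge0}\|\mathbf{M}_2^k\|<+\infty$; (iv) $r>0$, $\rho\in(0,2)$ and $\mu_1\ge0$ are such that $r\ge4T_0L>0$ and $2\mathbf{M}_1^k+rA^*A\succcurlyeq\big(L+\frac{C_{\mathbf M}}{r}\big)\mathrm{Id}$ for all $k\ge0$, where $C_{\mathbf M}:=(6\mu_1^2+4(L+\mu_1)^2)T_0$ for Algorithm 1 and $C_{\mathbf M}:=(4\mu_1^2+6(L+\mu_1)^2)T_0$ for Algorithm 2. Regularized augmented Lagrangian. $\mathcal{F}_r\colon\mathbb{R}^n\times\mathbb{R}^m\times\mathbb{R}^m\times\mathbb{R}^n\times\mathbb{R}^m\to\mathbb{R}\cup\{+\infty\}$, $\mathcal{F}_r(x,z,y,x',y')=\mathcal{L}_r(x,z,y)+T_1\|A^*(y-y')\|^2+\frac{C_1}{2}\|x-x'\|^2$, where $T_1:=\frac{1-\rho}{\lambda_{\min}(AA^* )\rho^2r}$ if $0<\rho\le1$, $T_1:=\frac{\rho-1}{\lambda_{\min}(AA^* )(2-\rho)\rho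 r}$ if $1<\rho<2$, and $C_1:=\frac{4T_0\mu_1^2}{r}$ for Algorithm 1, $C_1:=\frac{4T_0(L+\mu_1)^2}{r}$ for Algorithm 2. *)

(* Defs.v *)
From HB Require Import structures.
From mathcomp Require Import all_boot all_order all_algebra.
From mathcomp Require Import all_classical all_reals all_analysis.

Set Implicit Arguments.
Unset Strict Implicit.
Unset Printing Implicit Defensive.
Import Order.TTheory GRing.Theory Num.Theory numFieldNormedType.Exports.
Local Open Scope classical_set_scope.
Local Open Scope ring_scope.

(* A point of R^N is a column vector 'cV[R]_N.  The library norm `|_| on matrices
   is the sup norm; the Euclidean norm is [enorm].  Limits, neighborhoods,
   boundedness and differentiability are the library's: the two norms are
   equivalent, hence induce the same notions. *)

Section Euclidean.
Context {R : realType}.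

Definition inner {N} (u v : 'cV[R]_N) : R := \sum_i u i 0 * v i 0.

Definition enorm {N} (u : 'cV[R]_N) : R := Num.sqrt (inner u u).

Definition opnorm {p q} (M : 'M[R]_(p, q)) : R :=
  sup [set enorm (M *m u) | u in [set u : 'cV[R]_q | enorm u <= 1]].

Definition wnorm2 {N} (M : 'M[R]_N) (u : 'cV[R]_N) : R := inner (M *m u) u.

Definition loewner_ge {N} (M M' : 'M[R]_N) : Prop :=
  forall u, wnorm2 M' u <= wnorm2 M u.

Definition symmetric_psd {N} (M : 'M[R]_N) : Prop :=
  M^T = M /\ loewner_ge M 0.

(* Meant for symmetric matrices of size at least 1, whose set of eigenvalues is
   finite and nonempty, so that the infimum is a minimum. *)
Definition lambda_min {N} (M : 'M[R]_N) : R := inf [set a | eigenvalue M a].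

Definition gradient {N} (f : 'cV[R]_N -> R) (u : 'cV[R]_N) : 'cV[R]_N :=
  \col_i 'd f u (delta_mx i 0).

Definition argmin {d} {V : porderType d} {T : Type} (f : T -> V) : set T :=
  [set u | forall v, (f u <= f v)%O].

End Euclidean.

Section Subdifferential.
Context {R : realType} {N : nat}.
Implicit Types (Psi : 'cV[R]_N -> \bar R) (u v d : 'cV[R]_N).
Local Open Scope ereal_scope.

Definition proper Psi : Prop :=
  (forall u, Psi u != -oo) /\ exists u, Psi u < +oo.

Definition frechet_subdiff Psi u : set 'cV[R]_N :=
  [set d | Psi u \is a fin_num /\
    0 <= limf_einf (fun v => (Psi v - Psi u - (inner d (v - u)%R)%:E)
                             * ((enorm (v - u)%R)^-1)%:E) u^'].

Definition limiting_subdiff Psi u : set 'cV[R]_N :=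
  [set d | Psi u \is a fin_num /\
    exists us ds : nat -> 'cV[R]_N,
      [/\ us @ \oo --> u, ds @ \oo --> d, (Psi \o us) @ \oo --> Psi u
        & forall k, frechet_subdiff Psi (us k) (ds k)]].

(* +oo when [S] is empty. *)
Definition dist u (S : set 'cV[R]_N) : \bar R :=
  ereal_inf [set (enorm (u - v)%R)%:E | v in S].

(* The class Phi_eta; only the values of [phi] on [0, eta[ matter. *)
Definition desingularizing (eta : \bar R) (phi : R -> R) : Prop :=
  let D := [set s : R | (0 <= s)%R /\ s%:E < eta] in
  [/\ [/\ forall s, D s -> (0 <= phi s)%R, phi 0%R = 0%R
        & {within D, continuous phi}],
      convex_function (E := R^o) D (fun s => - phi s)%R
    & forall s : R, (0 < s)%R -> s%:E < eta ->
        [/\ derivable phi s 1%R, {for s, continuous (derive1 phi)}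
          & (0 < derive1 phi s)%R]].

Definition KL_at Psi u0 : Prop :=
  exists (eta : \bar R) (U : set 'cV[R]_N) (phi : R -> R),
    [/\ 0 < eta, nbhs u0 U, desingularizing eta phi
      & forall u, U u -> Psi u0 < Psi u -> Psi u < Psi u0 + eta ->
          1 <= (derive1 phi (fine (Psi u - Psi u0)))%:E
               * dist 0%R (limiting_subdiff Psi u)].

Definition KL_function Psi : Prop :=
  forall u, limiting_subdiff Psi u !=set0 -> KL_at Psi u.

End Subdifferential.

Inductive algorithm := Alg1 | Alg2.

Section ProximalADMM.
Context {R : realType} {n m : nat}.
Variables (alg : algorithm).
Variables (g : 'cV[R]_m -> \bar R) (h : 'cV[R]_n -> R) (A : 'M[R]_(m, n)).
Variables (L r rho : R).
Variables (M1 : nat -> 'M[R]_n) (M2 : nat -> 'M[R]_m).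

Definition aug_lagrangian (x : 'cV[R]_n) (z y : 'cV[R]_m) : \bar R :=
  (g z + (h x + inner y (A *m x - z) + r / 2 * enorm (A *m x - z) ^+ 2)%:E)%E.

Definition z_objective k (x : 'cV[R]_n) (zk y z : 'cV[R]_m) : \bar R :=
  (g z + (inner y (A *m x - z) + r / 2 * enorm (A *m x - z) ^+ 2
          + 1 / 2 * wnorm2 (M2 k) (z - zk))%:E)%E.

Definition x_objective k (xk : 'cV[R]_n) (z y : 'cV[R]_m) (x : 'cV[R]_n) : R :=
  match alg with
  | Alg1 => h x
  | Alg2 => inner (x - xk) (gradient h xk)
  end
  + inner y (A *m x - z) + r / 2 * enorm (A *m x - z) ^+ 2
  + 1 / 2 * wnorm2 (M1 k) (x - xk).

Definition generated (x : nat -> 'cV[R]_n) (z y : nat -> 'cV[R]_m) : Prop :=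
  forall k,
    [/\ argmin (z_objective k (x k) (z k) (y k)) (z k.+1),
        argmin (x_objective k (x k) (z k.+1) (y k)) (x k.+1)
      & y k.+1 = y k + (rho * r) *: (A *m x k.+1 - z k.+1)].

Definition lamA : R := lambda_min (A *m A^T).

Definition T0 : R :=
  if rho <= 1 then 1 / (lamA * rho) else rho / (lamA * (2 - rho) ^+ 2).

Definition T1 : R :=
  if rho <= 1 then (1 - rho) / (lamA * rho ^+ 2 * r)
  else (rho - 1) / (lamA * (2 - rho) * rho * r).

Definition mu1 : R := sup (range (fun k => opnorm (M1 k))).

Definition C_M : R :=
  match alg with
  | Alg1 => (6 * mu1 ^+ 2 + 4 * (L + mu1) ^+ 2) * T0
  | Alg2 => (4 * mu1 ^+ 2 + 6 * (L + mu1) ^+ 2) * T0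
  end.

Definition C1 : R :=
  match alg with
  | Alg1 => 4 * T0 * mu1 ^+ 2 / r
  | Alg2 => 4 * T0 * (L + mu1) ^+ 2 / r
  end.

Definition setting : Prop :=
  [/\ proper g /\ lower_semicontinuous g,
      (forall x, differentiable h x) /\
      (forall x x',
         enorm (gradient h x - gradient h x') <= L * enorm (x - x')),
      (forall k, symmetric_psd (M1 k)) /\ (forall k, symmetric_psd (M2 k))
    & 0 < r /\ 0 < rho < 2].

Definition assumption_A : Prop :=
  [/\ (exists b : R, forall z, (b%:E <= g z)%E) /\
      (exists b : R, forall x, b <= h x),
      forall w : 'cV[R]_m, exists v : 'cV[R]_n, A *m v = w,
      has_ubound (range (fun k => opnorm (M1 k))) /\
      has_ubound (range (fun k => opnorm (M2 k)))
    & [/\ 4 * T0 * L <= r, 0 < 4 * T0 * L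
        & forall k, loewner_ge (2 *: M1 k + r *: (A^T *m A))
                               (L + C_M / r)%:M]].

Definition reg_aug_lagrangian (x : 'cV[R]_n) (z y : 'cV[R]_m)
    (x' : 'cV[R]_n) (y' : 'cV[R]_m) : \bar R :=
  (aug_lagrangian x z y
   + (T1 * enorm (A^T *m (y - y')) ^+ 2 + C1 / 2 * enorm (x - x') ^+ 2)%:E)%E.

(* The same function on the Euclidean space R^(n+m+m+n+m), with
   u = (x, z, y, x', y'). *)
Definition reg_aug_lagrangian_stacked
    (u : 'cV[R]_(n + (m + (m + (n + m))))) : \bar R :=
  let zyxy := dsubmx u in
  let yxy := dsubmx zyxy in
  let xy := dsubmx yxy in
  reg_aug_lagrangian (usubmx u) (usubmx zyxy) (usubmx yxy)
                     (usubmx xy) (dsubmx xy).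

Definition KKT (x : 'cV[R]_n) (z y : 'cV[R]_m) : Prop :=
  [/\ - (A^T *m y) = gradient h x, limiting_subdiff g z y & z = A *m x].

End ProximalADMM.

(* Main.v *)
Require Import Defs.
From HB Require Import structures.
From mathcomp Require Import all_boot all_order all_algebra.
From mathcomp Require Import all_classical all_reals all_analysis.
From mathcomp Require Import ring lra.
Set Implicit Arguments.
Unset Strict Implicit.
Unset Printing Implicit Defensive.
Import Order.TTheory GRing.Theory Num.Theory numFieldNormedType.Exports.
Local Open Scope classical_set_scope.
Local Open Scope ring_scope.

(** Both algorithms are descent methods for the function [F] obtained from the
augmented Lagrangian by adding multiples of [|A^T (y - y')|^2] and
[|x - x'|^2].  Write [u_k] for the point of [F] made of the iterate of index
[k + 1] and of its predecessor, [d_k = |x_{k+1} - x_k|] and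
[s_k = |A^T (y_{k+1} - y_k)|].

Descent.  Optimality of the [x]-step says that [A^T y_k + r A^T (A x_{k+1} -
z_{k+1})] is the vector [v_k = - grad h - M1_k (x_{k+1} - x_k)]
([x_optimality]), so that [A^T y_{k+1} = rho v_k + (1 - rho) A^T y_k].
Differences of the [v_k] are controlled by [d_{k+1}] and [d_k], and convexity of
the square turns the relaxation into a telescoping bound of [|y_{k+2} -
y_{k+1}|^2] ([dy_sqr_telescope]).  The dual ascent increases the Lagrangian by a multiple
of this square; the increase is compensated by the two terms added to the
Lagrangian and by the gain of the [x]-step, so that [F] decreases along [u_k] by
a positive multiple of [d_{k+1}^2] ([energy_decrease]).

Subgradients.  All subgradients that occur satisfy their inequality globally, up
to a quadratic error: the [z]-step minimizes [g] plus a quadratic, and [h] differs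
from its linearization by at most [L / 2] times the square of the displacement
([quadratic_bound]).  Such vectors are Frechet subgradients
([proximal_frechet_subdiff]).  This yields a subgradient of [F] at [u_{k+1}] of
norm at most a multiple of [d_{k+1} + s_{k+1} + s_k] ([subgrad_le]).

Limit points.  Boundedness of the iterates bounds [F] from below along [u_k],
hence [d_k] and then [s_k] tend to 0.  At a cluster point [u], minimality in the
[z]-step and lower semicontinuity show that [g] converges along the subsequence;
therefore [F u] is the limit of the values, 0 is a limiting subgradient there, and
the Karush-Kuhn-Tucker conditions hold ([cluster_critical]).

Finite length.  Near [u], concavity of the desingularizing function [phi] combines
the Kurdyka-Lojasiewicz inequality, descent and the subgradient bound into
[d_{k+2} <= kappa (d_{k+1} + s_{k+1} + s_k) + C (f_k - f_{k+1})] with [kappa]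
arbitrarily small and [f_k = phi (F u_{k+1} - F u)] ([KL_step_length]).  Together
with [s_{k+1} <= |1 - rho| s_k + p (d_{k+1} + d_k)] this makes a weighted sum [E_k]
of the steps satisfy [E_{k+1} <= q E_k + C (f_k - f_{k+1})] with [q < 1].  The sum
of the steps taken while the sequence stays near [u] is therefore bounded by
initial data, which are arbitrarily small when the sequence is close to [u]: it
never leaves again ([trapped_sequence]).  This gives finite length and
convergence to [u] at once ([KL_finite_length]). *)

(** * Euclidean geometry *)

Section EuclideanTheory.
Context {R : realType} {N : nat}.
Implicit Types (u v w : 'cV[R]_N) (a : R).

Lemma innerC u v : inner u v = inner v u.
Proof. by apply: eq_bigr => i _; rewrite mulrC. Qed.

Lemma innerDl u v w : inner (u + v) w = inner u w + inner v w.
Proof. by rewrite /inner -big_split; apply: eq_bigr => i _; rewrite mxE mulrDl. Qed.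

Lemma innerZl a u v : inner (a *: u) v = a * inner u v.
Proof. by rewrite /inner mulr_sumr; apply: eq_bigr => i _; rewrite mxE mulrA. Qed.

Lemma innerNl u v : inner (- u) v = - inner u v.
Proof. by rewrite -scaleN1r innerZl mulN1r. Qed.

Lemma innerDr u v w : inner u (v + w) = inner u v + inner u w.
Proof. by rewrite innerC innerDl !(innerC u). Qed.

Lemma innerZr a u v : inner u (a *: v) = a * inner u v.
Proof. by rewrite innerC innerZl innerC. Qed.

Lemma innerNr u v : inner u (- v) = - inner u v.
Proof. by rewrite innerC innerNl innerC. Qed.

Lemma inner0l u : inner 0 u = 0.
Proof. by rewrite -(scale0r u) innerZl mul0r. Qed.

Lemma inner0r u : inner u 0 = 0.
Proof. by rewrite innerC inner0l. Qed.

Definition innerE := (innerDl, innerDr, innerNl, innerNr, innerZl, innerZr).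

Lemma inner_ge0 u : 0 <= inner u u.
Proof. by apply: sumr_ge0 => i _; rewrite -expr2 sqr_ge0. Qed.

Lemma enorm_ge0 u : 0 <= enorm u.
Proof. exact: sqrtr_ge0. Qed.

Lemma enorm_sqr u : enorm u ^+ 2 = inner u u.
Proof. by rewrite sqr_sqrtr // inner_ge0. Qed.

Lemma entry_le_enorm u i j : `|u i j| <= enorm u.
Proof.
rewrite -[leLHS]ger0_norm ?normr_ge0 // -[leRHS]ger0_norm ?enorm_ge0 //.
rewrite -ler_sqr ?nnegrE ?normr_ge0 ?enorm_ge0 // !normr_id.
rewrite (ger0_norm (enorm_ge0 u)) enorm_sqr /inner real_normK ?num_real //.
rewrite (ord1 j) (bigD1 i) //= -expr2 lerDl.
by apply: sumr_ge0 => k _; rewrite -expr2 sqr_ge0.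
Qed.

Lemma enorm0_eq0 u : enorm u = 0 -> u = 0.
Proof.
move=> u0; apply/matrixP => i j; rewrite mxE; apply/eqP.
by rewrite -normr_le0 -u0 entry_le_enorm.
Qed.

Lemma enorm0 : enorm (0 : 'cV[R]_N) = 0.
Proof. by rewrite /enorm inner0l sqrtr0. Qed.

Lemma enorm_gt0 u : (0 < enorm u) = (u != 0).
Proof.
rewrite lt_neqAle enorm_ge0 andbT eq_sym; congr negb.
by apply/eqP/eqP => [/enorm0_eq0//|->]; rewrite enorm0.
Qed.

Lemma enormZ a u : enorm (a *: u) = `|a| * enorm u.
Proof.
by rewrite /enorm innerZl innerZr mulrA -expr2 sqrtrM ?sqr_ge0 // sqrtr_sqr.
Qed.

Lemma enormN u : enorm (- u) = enorm u.
Proof. by rewrite -scaleN1r enormZ normrN1 mul1r. Qed.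

Lemma enormB u v : enorm (u - v) = enorm (v - u).
Proof. by rewrite -enormN opprB. Qed.

Lemma cauchy_schwarz u v : inner u v <= enorm u * enorm v.
Proof.
have [->|u0] := eqVneq u 0; first by rewrite inner0l enorm0 mul0r.
have [->|v0] := eqVneq v 0; first by rewrite inner0r enorm0 mulr0.
have pu : 0 < enorm u by rewrite enorm_gt0.
have pv : 0 < enorm v by rewrite enorm_gt0.
have := inner_ge0 (enorm v *: u - enorm u *: v).
rewrite !innerE -(enorm_sqr u) -(enorm_sqr v) (innerC v u) => H.
have : 0 <= (enorm u * enorm v) * (enorm u * enorm v - inner u v) by nra.
by rewrite pmulr_rge0 ?mulr_gt0 // subr_ge0.
Qed.

Lemma ler_enormD u v : enorm (u + v) <= enorm u + enorm v.
Proof.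
rewrite -ler_sqr ?nnegrE ?addr_ge0 ?enorm_ge0 //.
rewrite enorm_sqr !innerE -!enorm_sqr (innerC v u).
by have := cauchy_schwarz u v; lra.
Qed.

Lemma ler_enormB u v : enorm (u - v) <= enorm u + enorm v.
Proof. by rewrite -(enormN v) ler_enormD. Qed.

Lemma normr_inner_le u v : `|inner u v| <= enorm u * enorm v.
Proof.
rewrite ler_norml cauchy_schwarz andbT lerNl -innerNl.
by rewrite (le_trans (cauchy_schwarz _ _)) // enormN.
Qed.

Lemma mx_norm_le_enorm u : `|u| <= enorm u.
Proof.
rewrite [leLHS]mx_normrE; apply: bigmax_le; first exact: enorm_ge0.
by move=> [i j] _; apply: entry_le_enorm.
Qed.

Lemma col_sum_delta u : u = \sum_i u i 0 *: (delta_mx i 0 : 'cV_N).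
Proof.
apply/matrixP => i j; rewrite (ord1 j) summxE (bigD1 i) //= !mxE !eqxx mulr1.
by rewrite big1 ?addr0 // => k ki; rewrite !mxE eq_sym (negbTE ki) mulr0.
Qed.

Lemma enorm_le_mx_norm u : enorm u <= N%:R * `|u|.
Proof.
have entry i j : `|u i j| <= `|u|.
  rewrite [leRHS]mx_normrE; apply: (le_bigmax (T := R) _ (fun ij => `|u ij.1 ij.2|) (i, j)).
have d1 i : enorm (delta_mx i 0 : 'cV[R]_N) = 1.
  rewrite /enorm /inner (bigD1 i) //= !mxE !eqxx mulr1 big1 ?addr0 ?sqrtr1 //.
  by move=> k ki; rewrite !mxE (negbTE ki) mul0r.
have : enorm (\sum_i u i 0 *: (delta_mx i 0 : 'cV_N)) <= \sum_(i < N) `|u i 0|.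
  apply: (big_ind2 (fun (p : 'cV[R]_N) q => enorm p <= q)).
  - by rewrite enorm0.
  - by move=> p1 q1 p2 q2 h1 h2; rewrite (le_trans (ler_enormD _ _)) // lerD.
  - by move=> i _; rewrite enormZ d1 mulr1.
rewrite -col_sum_delta => /le_trans; apply.
apply: (le_trans (ler_sum _ (fun i _ => entry i 0))).
by rewrite sumr_const card_ord mulr_natl.
Qed.

End EuclideanTheory.

Lemma inner_mulmx {R : realType} {p q : nat} (M : 'M[R]_(p, q)) u v :
  inner (M *m u) v = inner u (M^T *m v).
Proof.
rewrite /inner (eq_bigr (fun i => \sum_j M i j * u j 0 * v i 0)); last first.
  by move=> i _; rewrite mxE mulr_suml.
rewrite exchange_big; apply: eq_bigr => j _; rewrite mxE mulr_sumr.
by apply: eq_bigr => i _; rewrite mxE; ring.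
Qed.

Section OperatorNorm.
Context {R : realType} {p q : nat} (M : 'M[R]_(p, q)).

Let opset := [set enorm (M *m u) | u in [set u : 'cV[R]_q | enorm u <= 1]].

Let opset_ub : has_ubound opset.
Proof.
exists (p%:R * (\sum_i \sum_j `|M i j|)) => _ [u /= u1 <-].
rewrite (le_trans (enorm_le_mx_norm _)) // ler_wpM2l //.
rewrite [leLHS]mx_normrE; apply: bigmax_le.
  by apply: sumr_ge0 => i _; apply: sumr_ge0.
move=> [i j] _ /=; rewrite mxE (le_trans (ler_norm_sum _ _ _)) //.
apply: (@le_trans _ _ (\sum_j `|M i j|)).
  apply: ler_sum => k _; rewrite normrM ler_piMr //.
  exact: le_trans (entry_le_enorm _ _ _) u1.
rewrite (bigD1 (P := xpredT) i) //= lerDl.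
by apply: sumr_ge0 => k _; apply: sumr_ge0.
Qed.

Lemma opnorm_ge0 : 0 <= opnorm M.
Proof.
rewrite -(@enorm0 R p) /opnorm; apply: (ub_le_sup opset_ub).
exists 0; last by rewrite mulmx0.
by rewrite /= enorm0 ler01.
Qed.

Lemma enorm_mulmx_le u : enorm (M *m u) <= opnorm M * enorm u.
Proof.
have [->|u0] := eqVneq u 0; first by rewrite mulmx0 !enorm0 mulr0.
have pu : 0 < enorm u by rewrite enorm_gt0.
rewrite -ler_pdivrMr // /opnorm; apply: (ub_le_sup opset_ub).
exists ((enorm u)^-1 *: u) => /=.
  by rewrite enormZ gtr0_norm ?invr_gt0 // mulVf ?gt_eqF.
by rewrite -scalemxAr enormZ gtr0_norm ?invr_gt0 // mulrC.
Qed.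

End OperatorNorm.

(** * Sequences of vectors and of real numbers *)

Section EuclideanTopology.
Context {R : realType} {N : nat}.
Implicit Types (u v : 'cV[R]_N).

Lemma nbhs_enormP (u : 'cV[R]_N) (U : set 'cV[R]_N) :
  nbhs u U <-> exists2 e : R, 0 < e & forall v, enorm (v - u) < e -> U v.
Proof.
split=> [/nbhs_ballP[e /= e0 eU]|[e e0 eU]].
  exists e => // v vu; apply: eU; rewrite -ball_normE /ball_ /= distrC.
  exact: le_lt_trans (mx_norm_le_enorm _) vu.
apply/nbhs_ballP; exists (e / N.+1%:R) => /=; first by rewrite divr_gt0.
move=> v; rewrite -ball_normE /ball_ /= distrC => vu; apply: eU.
apply: (le_lt_trans (enorm_le_mx_norm _)).
apply: (@le_lt_trans _ _ (N.+1%:R * `|v - u|)).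
  by rewrite ler_wpM2r // ler_nat.
by rewrite mulrC -ltr_pdivlMr.
Qed.

Lemma cvg_enormP (us : nat -> 'cV[R]_N) u :
  us @ \oo --> u <->
  forall e : R, 0 < e -> \forall k \near \oo, enorm (us k - u) < e.
Proof.
split=> [usu e e0|H].
  by apply: (usu [set v | enorm (v - u) < e]); apply/nbhs_enormP; exists e.
move=> U /nbhs_enormP[e e0 eU].
by apply: filterS (H e e0) => k; apply: eU.
Qed.

Lemma cvg_enorm0P (us : nat -> 'cV[R]_N) u :
  us @ \oo --> u <-> (fun k => enorm (us k - u)) @ \oo --> (0 : R).
Proof.
rewrite cvg_enormP; split=> [H|H e e0].
  apply/cvgrPdist_lt => e e0; near=> k; rewrite sub0r normrN.
  by rewrite ger0_norm ?enorm_ge0 //; near: k; apply: H.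
have /cvgrPdist_lt/(_ e e0) := H.
by apply: filterS => k; rewrite sub0r normrN ger0_norm ?enorm_ge0.
Unshelve. all: by end_near. Qed.

End EuclideanTopology.

Section BoundedCompact.
Context {R : realType} {N : nat}.

Lemma trmx_continuous p q : continuous (trmx : 'M[R]_(p, q) -> 'M[R]_(q, p)).
Proof.
move=> M s /= /nbhs_ballP[e e0 es]; apply/nbhs_ballP; exists e => //= M' [_ MM'].
by apply: es; split => // i j; rewrite !mxE; exact: MM'.
Qed.

(** The Heine-Borel theorem for row vectors, transposed. *)
Lemma box_compact (b : R) :
  compact [set u : 'cV[R]_N | forall i, `|u i 0| <= b].
Proof.
have cb : compact [set v : 'rV[R]_N | forall i, `[- b, b]%classic (v ord0 i)].
  by apply: (@rV_compact _ _ (fun=> `[- b, b]%classic)) => _; apply: segment_compact.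
have := continuous_compact (continuous_subspaceT (@trmx_continuous 1 N)) cb.
congr compact; apply/seteqP; split=> [_ [v /= vb <-] i|u /= ub].
  by rewrite mxE ler_norml; have := vb i; rewrite /= in_itv.
exists u^T; last by rewrite trmxK.
by move=> i /=; rewrite mxE in_itv /= -ler_norml.
Qed.

Lemma bounded_seq_cluster (us : nat -> 'cV[R]_N) (b : R) :
  (forall k, enorm (us k) <= b) ->
  exists u, forall (e : R) (K : nat), 0 < e ->
    exists2 k, (K <= k)%N & enorm (us k - u) < e.
Proof.
move=> usb.
have usB : (us @ \oo) [set u : 'cV[R]_N | forall i, `|u i 0| <= b].
  by exists 0 => // k _ i; rewrite (le_trans (entry_le_enorm _ _ _)).
have [u [_ clu]] := box_compact (fmap_proper_filter us eventually_filter) usB.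
exists u => e K e0.
have [||v [[k Kk <-] uv]] := clu (us @` [set k | (K <= k)%N]) [set v | enorm (v - u) < e].
- by exists K => // k Kk; exists k.
- by apply/nbhs_enormP; exists e.
by exists k.
Qed.

End BoundedCompact.

Section RealSequences.
Context {R : realType}.

(** [D] is the distance to the cluster point, [E] a step length.  The inequality
between steps is known only while [D] is small; as long as it holds, it bounds
the sum of the steps by the data at time [K], and these data are so small that
the sum cannot carry [D] up to [del]. *)
Lemma trapped_sequence (E D f : nat -> R) (q C B del : R) (K : nat) :
  q < 1 -> 0 <= C -> 0 <= B ->
  (forall k, 0 <= E k) -> (forall k, (K <= k)%N -> 0 <= f k) ->
  (forall k, D k.+1 <= D k + B * (E k + E k.+1)) ->
  (forall k, (K <= k)%N -> D k < del ->
     E k.+1 <= q * E k + C * (f k - f k.+1)) ->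
  D K + (2 * B / (1 - q) + B) * (E K + C * f K) < del ->
  forall k, D (K + k)%N < del /\
    (1 - q) * (\sum_(0 <= i < k) E (K + i)%N) <= E K + C * f K.
Proof.
move=> q1 C0 B0 E0 f0 stepD stepE start k.
have q1' : 0 < 1 - q by lra.
(* the two invariants of the induction below keep [D] under [del] *)
have fin j (S := \sum_(0 <= i < j) E (K + i)%N) :
    (1 - q) * S + E (K + j)%N + C * f (K + j)%N <= E K + C * f K ->
    D (K + j)%N <= D K + 2 * B * S + B * E (K + j)%N -> D (K + j)%N < del.
  move=> hE hD; apply: le_lt_trans start; apply: (le_trans hD).
  have Cf : 0 <= C * f (K + j)%N by rewrite mulr_ge0 // f0 // leq_addr.
  have Ej := E0 (K + j)%N.
  have S0 : 0 <= S by apply: sumr_ge0.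
  have hS : S <= (E K + C * f K) / (1 - q) by rewrite ler_pdivlMr //; lra.
  have h1 : 2 * B * S <= 2 * B * ((E K + C * f K) / (1 - q)).
    by rewrite ler_wpM2l // mulr_ge0.
  have h2 : B * E (K + j)%N <= B * (E K + C * f K).
    by rewrite ler_wpM2l //; have := mulr_ge0 (ltW q1') S0; lra.
  lra.
have [hE hD] : (1 - q) * (\sum_(0 <= i < k) E (K + i)%N) + E (K + k)%N
      + C * f (K + k)%N <= E K + C * f K /\
    D (K + k)%N <= D K + 2 * B * (\sum_(0 <= i < k) E (K + i)%N)
      + B * E (K + k)%N.
  elim: k => [|k [hE hD]].
    rewrite big_geq // addn0 !mulr0 add0r addr0; split=> //.
    by rewrite lerDl mulr_ge0.
  have := stepE _ (leq_addr k K) (fin _ hE hD); have := stepD (K + k)%N.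
  by rewrite big_nat_recr //= addnS => h1 h2; split; lra.
split; first exact: fin hE hD.
have Cf : 0 <= C * f (K + k)%N by rewrite mulr_ge0 // f0 // leq_addr.
by have := E0 (K + k)%N; lra.
Qed.

Lemma cvg0_contraction (s e : nat -> R) (th : R) :
  0 <= th -> th < 1 -> (forall k, 0 <= s k) ->
  (forall k, s k.+1 <= th * s k + e k) ->
  e @ \oo --> (0 : R) -> s @ \oo --> (0 : R).
Proof.
move=> th0 th1 s0 rec /cvgrPdist_lt e_0; apply/cvgrPdist_le => eps eps0.
have th1' : 0 < 1 - th by lra.
have e2 : 0 < (eps : R) / 2 by rewrite divr_gt0.
have [K _ eK] := e_0 _ (mulr_gt0 th1' e2).
have geo j : s (K + j)%N - eps / 2 <= th ^+ j * s K.
  elim: j => [|j IH]; first by rewrite addn0 expr0 mul1r; lra.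
  have := eK (K + j)%N (leq_addr j K).
  rewrite sub0r normrN => /(le_lt_trans (ler_norm _)) ej.
  have := rec (K + j)%N; rewrite addnS exprS -mulrA => h.
  have : th * (s (K + j)%N - eps / 2) <= th * (th ^+ j * s K) by rewrite ler_wpM2l.
  by move: (th ^+ j * s K) h ej => G; lra.
have : (fun j => th ^+ j * s K) @ \oo --> (0 : R).
  rewrite -(mul0r (s K)); apply: cvgM; last exact: cvg_cst.
  by apply: cvg_expr; rewrite ger0_norm.
move=> /cvgrPdist_lt/(_ _ e2)[J _ HJ].
exists (K + J)%N => // k /= Kk; rewrite sub0r normrN ger0_norm //.
have Kk' : (K <= k)%N by rewrite (leq_trans _ Kk) // leq_addr.
have := HJ (k - K)%N; rewrite /= leq_subRL // Kk => /(_ isT).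
rewrite sub0r normrN => /(le_lt_trans (ler_norm _)) h.
by have := geo (k - K)%N; rewrite subnKC //; lra.
Qed.

Lemma nneseries_lt_pinfty (u : nat -> R) (b : R) :
  (forall k, 0 <= u k) -> (forall n, \sum_(0 <= k < n) u k <= b) ->
  (\sum_(0 <= k <oo) (u k)%:E < +oo)%E.
Proof.
move=> u0 ub; apply: (@le_lt_trans _ _ b%:E); last exact: ltry.
apply: lime_le; first by apply: is_cvg_nneseries => k _ _; rewrite lee_fin.
by apply: nearW => n; rewrite sumEFin lee_fin.
Qed.

Lemma cvg0_summable (u : nat -> R) (b : R) :
  (forall k, 0 <= u k) -> (forall n, \sum_(0 <= k < n) u k <= b) ->
  u @ \oo --> (0 : R).
Proof.
move=> u0 ub; apply: cvg_series_cvg_0.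
apply: nondecreasing_is_cvgn.
  by apply/nondecreasing_seqP => n; rewrite /series /= big_nat_recr //= lerDl.
by exists b => _ [n _ <-]; exact: ub.
Qed.

Lemma cvg0_sqr (u : nat -> R) :
  (fun k => u k ^+ 2) @ \oo --> (0 : R) -> u @ \oo --> (0 : R).
Proof.
move=> /cvgrPdist_lt H; apply/cvgrPdist_lt => e e0.
apply: filterS (H (e ^+ 2) (exprn_gt0 2 e0)) => k.
rewrite !sub0r !normrN normrX => h.
by rewrite -(@ltr_pXn2r _ 2) // nnegrE // ltW.
Qed.

End RealSequences.

(** * First order tests and the Rayleigh bound *)

Section QuadraticTests.
Context {R : realType} {N : nat}.
Implicit Types (u v w G : 'cV[R]_N).

(** This is the first order condition at a minimum, for objectives bounded above
by their linearization plus a quadratic. *)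
Lemma inner_quadratic_ge0_eq0 G (C : R) :
  (forall v, 0 <= inner G v + C * enorm v ^+ 2) -> G = 0.
Proof.
move=> H; apply: enorm0_eq0; apply/eqP; rewrite -sqrf_eq0.
have [t t0 tE] : exists2 t : R, 0 < t & t * (`|C| + 1) = 1.
  exists (`|C| + 1)^-1; first by rewrite invr_gt0 ltr_wpDl.
  by rewrite mulVf // gt_eqF // ltr_wpDl.
(* a step against [G], short enough for the linear term to dominate *)
have := H (- t *: G); rewrite innerZr enormZ normrN gtr0_norm // -enorm_sqr exprMn.
have Ct : C * t <= 1 - t.
  by have := ler_wpM2r (ltW t0) (ler_norm C); lra.
move: (enorm G ^+ 2) (sqr_ge0 (enorm G)) => g g0 h.
rewrite eq_le g0 andbT leNgt; apply/negP => gp.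
have := ler_wpM2l (ltW (mulr_gt0 t0 gp)) Ct.
by have := mulr_gt0 t0 (mulr_gt0 t0 gp); lra.
Qed.

(** Expanding the form [P] at [u - t P u] bounds [|P u|^2] by the value of the
form at [u]: a positive semidefinite matrix cannot move a vector on which its
form is small. *)
Lemma enorm_psd_sqr_le (P : 'M[R]_N) u :
  P^T = P -> (forall v, 0 <= inner (P *m v) v) ->
  enorm (P *m u) ^+ 2 <= (opnorm P + 1) * inner (P *m u) u.
Proof.
move=> PT Ppsd; set p := opnorm P; have p0 : 0 <= p := opnorm_ge0 P.
have Pp : inner (P *m (P *m u)) (P *m u) <= p * enorm (P *m u) ^+ 2.
  rewrite (le_trans (cauchy_schwarz _ _)) // expr2 mulrA.
  by rewrite ler_wpM2r ?enorm_ge0 ?enorm_mulmx_le.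
have [t t0 tE] : exists2 t : R, 0 < t & t * (p + 1) = 1.
  exists (p + 1)^-1; first by rewrite invr_gt0 ltr_wpDl.
  by rewrite mulVf // gt_eqF // ltr_wpDl.
have pt : p * t = 1 - t by lra.
have := Ppsd (u - t *: (P *m u)).
rewrite mulmxBr -scalemxAr !innerE.
rewrite (inner_mulmx P (P *m u) u) PT -enorm_sqr.
move: (enorm (P *m u) ^+ 2) (sqr_ge0 (enorm (P *m u))) Pp => g g0.
move: (inner (P *m (P *m u)) (P *m u)) (inner (P *m u) u) => a b h1 h2.
have h3 : t * a <= (1 - t) * g by rewrite -pt; have := ler_wpM2l (ltW t0) h1; lra.
have h4 : t * g <= b.
  have : t * (t * a) <= t * ((1 - t) * g) by rewrite ler_wpM2l // ltW.
  have : 0 <= t * (t * g) by rewrite !mulr_ge0 // ltW.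
  lra.
have p1 : 0 <= p + 1 by lra.
have E : (p + 1) * (t * g) = g by rewrite mulrA (mulrC _ t) tE mul1r.
by rewrite -[leLHS]E ler_wpM2l.
Qed.

Lemma wnorm2_ge0 (M : 'M[R]_N) u : symmetric_psd M -> 0 <= wnorm2 M u.
Proof. by case=> _ /(_ u); rewrite /wnorm2 mul0mx inner0l. Qed.

Lemma eigenvalue_psd_ge0 (B : 'M[R]_N) a :
  symmetric_psd B -> eigenvalue B a -> 0 <= a.
Proof.
move=> Bpsd /eigenvalueP[v vB v0].
have BvT : B *m v^T = a *: v^T by rewrite -{1}(proj1 Bpsd) -trmx_mul vB linearZ.
have vT0 : v^T != 0 by rewrite -(inj_eq trmx_inj) trmxK trmx0.
have := wnorm2_ge0 v^T Bpsd; rewrite /wnorm2 BvT innerZl -enorm_sqr pmulr_lge0 //.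
by rewrite exprn_gt0 // enorm_gt0.
Qed.

(** The infimum [c] of the Rayleigh quotient is an eigenvalue: otherwise the
positive semidefinite matrix [B - c] is invertible, hence bounded from below by
a positive constant on the unit sphere, which contradicts the choice of [c]. *)
Lemma lambda_min_le (B : 'M[R]_N) u :
  symmetric_psd B -> lambda_min B * inner u u <= inner (B *m u) u.
Proof.
move=> BP; have [BT _] := BP; have Bpsd v : 0 <= inner (B *m v) v := wnorm2_ge0 v BP.
have [->|u0] := eqVneq u 0; first by rewrite mulmx0 !inner0r mulr0.
have unit v : v != 0 -> enorm ((enorm v)^-1 *: v) = 1.
  move=> v0; have vp : 0 < enorm v by rewrite enorm_gt0.
  by rewrite enormZ gtr0_norm ?invr_gt0 // mulVf ?gt_eqF.
pose S := [set inner (B *m v) v | v in [set v | enorm v = 1]].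
have S0 : S !=set0 by eexists; exists ((enorm u)^-1 *: u); first exact: unit.
have Slb : has_lbound S by exists 0 => _ [v _ <-].
set c := inf S.
have c_le v : c * inner v v <= inner (B *m v) v.
  have [->|v0] := eqVneq v 0; first by rewrite mulmx0 !inner0r mulr0.
  have vp : 0 < enorm v by rewrite enorm_gt0.
  have : c <= inner (B *m ((enorm v)^-1 *: v)) ((enorm v)^-1 *: v).
    by apply: (ge_inf Slb); eexists; last reflexivity; apply: unit.
  rewrite -scalemxAr innerZl innerZr mulrA -expr2 exprVn.
  by rewrite ler_pdivlMl ?exprn_gt0 // mulrC enorm_sqr.
suff Ec : eigenvalue B c.
  apply: le_trans (c_le u); apply: ler_wpM2r; first exact: inner_ge0.
  by apply: ge_inf Ec; exists 0 => a; exact: eigenvalue_psd_ge0 BP.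
set P := B - c%:M.
have PE v : inner (P *m v) v = inner (B *m v) v - c * inner v v.
  by rewrite mulmxBl mul_scalar_mx innerDl innerNl innerZl.
have Ppsd v : 0 <= inner (P *m v) v by rewrite PE subr_ge0.
have PT : P^T = P by rewrite linearB /= BT tr_scalar_mx.
rewrite /eigenvalue /eigenspace -/P kermx_eq0 row_free_unit.
apply/negP => Pu; set K := opnorm (invmx P).
set M := K ^+ 2 * (opnorm P + 1).
have M0 : 0 <= M by rewrite mulr_ge0 ?sqr_ge0 // addr_ge0 ?opnorm_ge0.
have h v : enorm v = 1 -> 1 <= M * (inner (B *m v) v - c).
  move=> v1; have := enorm_mulmx_le (invmx P) (P *m v).
  rewrite mulmxA mulVmx // mul1mx v1 => h1.
  have h2 : 1 <= (K * enorm (P *m v)) ^+ 2.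
    rewrite -(expr1n _ 2) ler_pXn2r // nnegrE //.
    by rewrite mulr_ge0 ?opnorm_ge0 ?enorm_ge0.
  apply: (le_trans h2); rewrite /M exprMn -mulrA ler_wpM2l ?sqr_ge0 //.
  have := @enorm_psd_sqr_le P v PT Ppsd; rewrite PE.
  by rewrite -(enorm_sqr v) v1 expr1n mulr1.
have : c + (M + 1)^-1 <= c.
  apply: lb_le_inf => // _ [v /= v1 <-].
  have := h _ v1; set X := inner _ _ - c => hX.
  have Xp : 0 < X by rewrite ltNge; apply/negP => X0; have := mulr_ge0_le0 M0 X0; lra.
  have : (M + 1)^-1 <= X.
    by rewrite -(mul1r _^-1) ler_pdivrMr ?ltr_wpDl // mulrC; lra.
  by rewrite /X; lra.
by rewrite gerDl leNgt invr_gt0 ltr_wpDl.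
Qed.

Lemma lambda_min_ge0 (B : 'M[R]_N) : symmetric_psd B -> 0 <= lambda_min B.
Proof.
move=> BP; rewrite /lambda_min.
have [->|E0] := eqVneq [set a | eigenvalue B a] set0; first by rewrite inf0.
by apply: lb_le_inf => [|a]; [exact/set0P|exact: eigenvalue_psd_ge0 BP].
Qed.

End QuadraticTests.

(** * Functions with a Lipschitz continuous gradient *)

Section DescentLemma.
Context {R : realType}.

(** The mean value theorem is applied to [p] minus its expected second order
expansion, and not to [p] minus its linearization: this is what keeps the
factor 1/2 on which the constants of the algorithms rely. *)
Lemma second_order_bound_1d (p dp : R -> R) (K : R) :
  (forall t : R, is_derive t (1 : R) p (dp t)) ->
  (forall t, 0 <= t -> dp t - dp 0 <= K * t) ->
  p 1 <= p 0 + dp 0 + K / 2.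
Proof.
move=> pd dpK.
pose q (t : R) := p t - dp 0 * t - K / 2 * t ^+ 2.
have qd (t : R) : is_derive t (1 : R) q (dp t - dp 0 - K * t).
  have H := is_deriveB (is_deriveB (pd t) (is_deriveZ (dp 0)
    (is_derive_id t (1 : R)))) (is_deriveZ (K / 2) (is_deriveX 2 (is_derive_id t (1 : R)))).
  by refine (is_derive_eq H _); rewrite /GRing.scale /= !mulr1 expr1; field.
have qc : {within `[0 : R, 1], continuous q}.
  by apply: derivable_within_continuous => x _; exact: ex_derive.
have [c c01 {}qc] := @MVT R q (fun t => dp t - dp 0 - K * t) 0 1 ltr01 (fun x _ => qd x) qc.
move: c01; rewrite in_itv /= => /andP[c0 _].
have := dpK c (ltW c0); move: qc; rewrite /q subr0 mulr1 expr0n expr1n /= !mulr0 !mulr1.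
lra.
Qed.

Context {N : nat}.

Lemma gradientE (h : 'cV[R]_N -> R) (u v : 'cV[R]_N) :
  differentiable h u -> 'd h u v = inner (gradient h u) v.
Proof.
move=> dh.
rewrite {1}(col_sum_delta v) linear_sum /inner; apply: eq_bigr => i _.
by rewrite linearZ /= mxE mulrC.
Qed.

Lemma is_derive_line (h : 'cV[R]_N -> R) (u v : 'cV[R]_N) (t : R) :
  (forall w, differentiable h w) ->
  is_derive t (1 : R) (fun t : R => h (u + t *: v)) (inner (gradient h (u + t *: v)) v).
Proof.
move=> dh; have dl : is_diff t (fun t : R => u + t *: v) ( *:%R ^~ v).
  have H := is_diffD (is_diff_cst u t) (is_diff_scalel t v).
  by refine (is_diff_eq H _); apply/funext => s; rewrite /= [LHS]add0r.
have dl' : differentiable (fun t : R => u + t *: v) t by case: dl.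
have dc : differentiable (h \o (fun t : R => u + t *: v)) t.
  by apply: differentiable_comp.
apply: DeriveDef; first exact/derivable1_diffP.
rewrite deriveE // diff_comp //=.
by rewrite diff_val scale1r gradientE.
Qed.

(** This restricts [h] to the segment from [u] to [u + v], in both directions of the
one-dimensional bound. *)
Lemma quadratic_bound (h : 'cV[R]_N -> R) (L : R) (u v : 'cV[R]_N) :
  (forall w, differentiable h w) ->
  (forall w w', enorm (gradient h w - gradient h w') <= L * enorm (w - w')) ->
  `|h (u + v) - h u - inner (gradient h u) v| <= L / 2 * enorm v ^+ 2.
Proof.
move=> dh lip.
have D (t : R) := @is_derive_line h u v t dh.
have bnd t : 0 <= t -> `|inner (gradient h (u + t *: v)) v - inner (gradient h u) v|
    <= L * enorm v ^+ 2 * t.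
  move=> t0; rewrite -innerNl -innerDl (le_trans (normr_inner_le _ _)) //.
  have := ler_wpM2r (enorm_ge0 v) (lip (u + t *: v) u).
  rewrite (addrC u) addrK enormZ ger0_norm //; move/le_trans; apply.
  by move: (enorm v) => n; rewrite le_eqVlt; apply/orP; left; apply/eqP; ring.
have e0 : u + 0 *: v = u by rewrite scale0r addr0.
have up := @second_order_bound_1d _ _ (L * enorm v ^+ 2) D.
have lo := @second_order_bound_1d _ _ (L * enorm v ^+ 2) (fun t => is_deriveN (D t)).
move: up lo; rewrite /= !fctE e0 scale1r => up lo.
have {}up := up (fun t t0 => le_trans (ler_norm _) (bnd t t0)).
have {lo} : - h (u + v) <= - h u - inner (gradient h u) v + L * enorm v ^+ 2 / 2.
  apply: lo => t t0; rewrite -opprD; apply: le_trans (bnd t t0).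
  by rewrite -normrN ler_norm.
move: up; move: (h (u + v)) (h u) (inner _ _) (enorm v ^+ 2) => a b c d up lo.
by rewrite ler_norml; apply/andP; split; lra.
Qed.

End DescentLemma.

(** * Subgradients and desingularizing functions *)

Section Subgradients.
Context {R : realType} {N : nat}.

(** Vectors satisfying the subgradient inequality up to a quadratic error are
proximal subgradients; divided by the distance, the error vanishes. *)
Lemma proximal_frechet_subdiff (Psi : 'cV[R]_N -> \bar R) u d (C : R) :
  Psi u \is a fin_num ->
  (forall v, (Psi u + (inner d (v - u) - C * enorm (v - u) ^+ 2)%:E <= Psi v)%E) ->
  frechet_subdiff Psi u d.
Proof.
move=> Pu H; split=> //; rewrite limf_einfE.
apply/lee_addgt0Pr => e e0.
have e1 : 0 < e / (`|C| + 1) by rewrite divr_gt0 // ltr_wpDl.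
set V := [set v | v != u /\ enorm (v - u) < e / (`|C| + 1)].
have FV : u^' V.
  have /nbhs_enormP : nbhs u [set v | enorm (v - u) < e / (`|C| + 1)].
    by apply/nbhs_enormP; exists (e / (`|C| + 1)).
  move=> /nbhs_enormP; rewrite /dnbhs /within /=; apply: filterS => v vu vneq.
  by split.
rewrite -leeBlDr //; apply: le_trans (ereal_sup_ubound _); last first.
  by exists V; [exact: FV|reflexivity].
apply: le_ereal_inf_tmp => _ [v [vu ve] <-].
have n0 : 0 < enorm (v - u) by rewrite enorm_gt0 subr_eq0.
have := H v; rewrite -(fineK Pu); set pu := fine (Psi u).
case: (Psi v) => [pv| |] /=.
- rewrite lee_fin add0e lee_fin ler_pdivlMr //.
  move: (inner _ _) (enorm _) n0 ve => c n n0 ve h.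
  have Cn : C * n <= e.
    have : (`|C| + 1) * n < e by rewrite mulrC -ltr_pdivlMr // ltr_wpDl.
    by have := ler_wpM2r (ltW n0) (ler_norm C); lra.
  by have := ler_wpM2r (ltW n0) Cn; move: h; rewrite expr2; lra.
- by move=> _; rewrite gt0_mulye ?leey // lte_fin invr_gt0.
- by rewrite leeNy_eq.
Qed.

End Subgradients.

Section Desingularizing.
Context {R : realType}.

(** A concave function lies below its tangents.  The point [s'] may be 0, where
[phi] need not be differentiable. *)
Lemma desingularizing_tangent (eta : \bar R) (phi : R -> R) (s s' : R) :
  desingularizing eta phi -> 0 <= s' -> s' < s -> (s%:E < eta)%E ->
  derive1 phi s * (s - s') <= phi s - phi s'.
Proof.
move=> [_ cvx /(_ s)] + s'0 s's seta.
have s0 : 0 < s by lra.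
move=> /(_ s0 seta)[dphi _ _].
rewrite -ler_pdivlMr ?subr_gt0 // leNgt; apply/negP => lt.
set q := _ / _ in lt.
have /cvgrPdist_lt : h^-1 *: (phi (h *: 1 + s) - phi s) @[h --> 0^'] --> derive1 phi s.
  by rewrite derive1E; exact: dphi.
move=> /(_ (derive1 phi s - q)); rewrite subr_gt0 => /(_ lt).
move=> /nbhs_ballP[e /= e0 He].
(* a convex combination [k + s] of [s] and [s'], close enough to [s] for the
   difference quotient to exceed the chord slope [q] *)
set tau := Num.min (1 / 2) (e / (2 * (s - s'))).
have ss : 0 < s - s' by lra.
have t0 : 0 < tau by rewrite lt_min divr_gt0 //= divr_gt0 // mulr_gt0.
have t1 : tau <= 1 / 2 by rewrite ge_min lexx.
have t2 : tau * (s - s') < e.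
  have : tau <= e / (2 * (s - s')) by rewrite ge_min lexx orbT.
  by rewrite ler_pdivlMr ?mulr_gt0 //; lra.
set k := tau * (s' - s).
have kn : k < 0 by rewrite pmulr_rlt0 // subr_lt0.
have k0 : k != 0 by rewrite lt_eqF.
have := He k; rewrite /ball /= sub0r normrN => /(_ _ k0).
have kE : `|k| = tau * (s - s').
  by rewrite ltr0_norm // /k; ring.
rewrite kE => /(_ t2); rewrite {1}/GRing.scale /= [k *: 1]mulr1 => h.
have ti : 0 <= tau <= 1 by apply/andP; split; lra.
have Ds : 0 <= s /\ (s%:E < eta)%E by split=> //; exact: ltW.
have Ds' : 0 <= s' /\ (s'%:E < eta)%E by split=> //; rewrite (lt_trans _ seta) ?lte_fin.
pose ti01 : {i01 R} := Itv01 (proj1 (andP ti)) (proj2 (andP ti)).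
have h2 : - phi (k + s) <= tau * - phi s' + (1 - tau) * - phi s.
  have -> : k + s = tau * s' + (1 - tau) * s by rewrite /k; ring.
  by have := cvx ti01 s' s; rewrite !inE => /(_ Ds' Ds); exact.
have qE : q * (s - s') = phi s - phi s' by rewrite /q mulfVK // gt_eqF.
set Q := k^-1 * _ in h; have QE : k * Q = phi (k + s) - phi s by rewrite /Q mulVKf.
have Qq : q < Q by have := le_lt_trans (ler_norm _) h; clear; lra.
have : k * Q < k * q by rewrite ltr_nM2l.
rewrite QE {QE h Qq Q}; move: h2; rewrite /k.
have -> : tau * (s' - s) * q = tau * - (phi s - phi s') by rewrite -qE; ring.
by clear; lra.
Qed.

Lemma desingularizing_cvg0 (eta : \bar R) (phi : R -> R) :
  (0 < eta)%E -> desingularizing eta phi ->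
  forall e : R, 0 < e -> exists2 del : R, 0 < del &
    forall s, 0 <= s -> s < del -> (s%:E < eta)%E -> phi s < e.
Proof.
move=> eta0 [[_ phi0 cphi] _ _] e e0.
have /subspace_continuousP/(_ 0) := cphi.
move=> /(_ (conj (lexx _) eta0)) /cvgrPdist_lt/(_ e e0).
move=> /nbhs_ballP[del /= del0 H]; exists del => // s s0 sdel seta.
have := H s; rewrite /ball /= sub0r normrN ger0_norm // => /(_ sdel (conj s0 seta)).
by rewrite /from_subspace phi0 sub0r normrN; apply: le_lt_trans (ler_norm _).
Qed.

End Desingularizing.

(** * Finite length from the Kurdyka-Lojasiewicz inequality *)

Section KLStep.
Context {R : realType}.

(** Here [s1], [s2] are two consecutive values above the critical one and [G]
bounds the slope of the function at the first.  By concavity [phi s1 - phi s2]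
is at least [phi' s1 * c * d ^+ 2], and the Kurdyka-Lojasiewicz inequality
replaces [phi' s1] by [1 / G]; the arithmetic-geometric mean inequality then
splits [d ^+ 2 <= G * (phi s1 - phi s2) / c] with a free weight [kap].  When the
values coincide, [d] vanishes. *)
Lemma KL_step_length (eta : \bar R) (phi : R -> R) (c kap s1 s2 d G : R) :
  desingularizing eta phi -> 0 < c -> 0 < kap -> 0 <= G -> 0 <= d ->
  0 <= s2 -> (s1%:E < eta)%E -> s2 + c * d ^+ 2 <= s1 ->
  (0 < s1 -> 1 <= derive1 phi s1 * G) ->
  d <= kap * G + (4 * c * kap)^-1 * (phi s1 - phi s2).
Proof.
move=> dphi c0 kap0 G0 d0 s20 s1eta dec kl.
have kG : 0 <= kap * G by rewrite mulr_ge0 // ltW.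
have cd0 : 0 <= c * d ^+ 2 by rewrite mulr_ge0 ?sqr_ge0 // ltW.
have [s12|] := ltP s2 s1; last first.
  move=> s12; have s12E : s1 = s2 by lra.
  have dz : d = 0.
    apply/eqP; rewrite -sqrf_eq0 -(mulrI_eq0 _ (lregP (lt0r_neq0 c0))); apply/eqP; lra.
  by rewrite dz s12E subrr mulr0 addr0.
have s10 : 0 < s1 by lra.
have tg := desingularizing_tangent dphi s20 s12 s1eta.
have P0 : 0 < derive1 phi s1 by case: dphi => _ _ /(_ s1 s10 s1eta)[].
have {kl} := kl s10; move: (derive1 phi s1) P0 tg => P P0 tg PG.
move: (phi s1 - phi s2) tg => eps tg.
have e1 : P * (c * d ^+ 2) <= eps.
  by apply: le_trans tg; rewrite ler_wpM2l ?(ltW P0) //; lra.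
have e0 : 0 <= eps by apply: le_trans e1; rewrite mulr_ge0 // ltW.
have e2 : c * d ^+ 2 <= G * eps.
  have h1 : G * (P * (c * d ^+ 2)) <= G * eps by rewrite ler_wpM2l.
  have h2 : (c * d ^+ 2) * 1 <= (c * d ^+ 2) * (P * G) by rewrite ler_wpM2l.
  by move: h1 h2; move: (c * d ^+ 2) => X; lra.
set y := (4 * c * kap)^-1 * eps.
have ck : 0 < 4 * c * kap by rewrite !mulr_gt0.
have y0 : 0 <= y by apply: mulr_ge0 => //; rewrite invr_ge0; exact: ltW.
have yE : eps = 4 * c * kap * y by rewrite /y mulVKf // gt_eqF.
have kGy : 0 <= kap * G + y by lra.
rewrite -ler_sqr ?nnegrE // -(ler_pM2l c0); apply: (le_trans e2).
rewrite yE -subr_ge0.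
have -> : c * (kap * G + y) ^+ 2 - G * (4 * c * kap * y) = c * (kap * G - y) ^+ 2 by ring.
by rewrite mulr_ge0 ?sqr_ge0 // ltW.
Qed.

End KLStep.

Section FiniteLength.
Context {R : realType} {N : nat}.

Lemma frechet_limiting_subdiff (Psi : 'cV[R]_N -> \bar R) u d :
  frechet_subdiff Psi u d -> limiting_subdiff Psi u d.
Proof.
move=> Fd; split; first by case: Fd.
by exists (fun=> u), (fun=> d); split => //; exact: cvg_cst.
Qed.

Lemma dist_le_enorm (S : set 'cV[R]_N) d : S d -> (dist 0%R S <= (enorm d)%:E)%E.
Proof. by move=> Sd; apply: ereal_inf_lbound; exists d => //; rewrite sub0r enormN. Qed.

(** A single subgradient bounds the distance of 0 to the subdifferential from
above. *)
Lemma KL_ineq_subgradient (Psi : 'cV[R]_N -> \bar R) u (phi : R -> R) (s G : R) d :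
  0 < derive1 phi s ->
  (1 <= (derive1 phi s)%:E * dist 0%R (limiting_subdiff Psi u))%E ->
  frechet_subdiff Psi u d -> enorm d <= G -> 1 <= derive1 phi s * G.
Proof.
move=> P0 kl Fd dG; rewrite -lee_fin EFinM; apply: (le_trans kl).
rewrite lee_pmul2l // ?lte_fin //; apply: le_trans (dist_le_enorm _) _.
  exact: frechet_limiting_subdiff Fd.
by rewrite lee_fin.
Qed.

(** Notation of [KL_finite_length].  The weight [be] makes the contribution of
[p * (d2 + d1)] at most a quarter of [d2 + d1], the weight of [s00] is half of the
gap [be * (1 - th)] of the contraction of [s], and 1/16 of that gap is a small enough share for the
terms that the Kurdyka-Lojasiewicz inequality adds. *)
Lemma two_step_contraction (be th p iv fd d2 d1 s2 s1 s00 : R) :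
  0 < be -> be * p = 1 / 4 - be -> 0 <= th -> th < 1 -> 0 <= d2 -> 0 <= d1 -> 0 <= s1 ->
  0 <= s00 -> d2 <= be * (1 - th) / 16 * (d1 + s1 + s00) + iv * fd ->
  s2 <= th * s1 + p * (d2 + d1) ->
  d2 + be * s2 + be * (1 - th) / 2 * s1 <=
  (3 + th) / 4 * (d1 + be * s1 + be * (1 - th) / 2 * s00) + 2 * iv * fd.
Proof.
move=> be0 bep th0 th1 d20 d10 s10 s000 key rec.
have r1 : be * s2 <= be * th * s1 + (1 / 4 - be) * (d2 + d1).
  by rewrite -bep -!mulrA -mulrDr ler_wpM2l // ltW.
have dl0 : 0 <= be * (1 - th) by rewrite mulr_ge0 ?subr_ge0 // ltW.
have a1 : 0 <= be * (1 - th) * s00 by rewrite mulr_ge0.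
have a2 : 0 <= be * (1 - th) * s00 * th by rewrite mulr_ge0.
have a3 : 0 <= be * (1 - th) * s1 by rewrite mulr_ge0.
have a4 : 0 <= d1 * th by rewrite mulr_ge0.
have a5 : 0 <= d1 * be by rewrite mulr_ge0 // ltW.
have a6 : 0 <= d1 * be * th by rewrite mulr_ge0.
have a7 : 0 <= d2 * be by rewrite mulr_ge0 // ltW.
lra.
Qed.

(** The abstract convergence theorem behind the result.  Descent controls only the
part [d] of the steps, whereas the subgradients and the displacement also involve
a second part [s], which [d] drives through a contraction.  The two parts are
recombined in the single quantity [E], to which [trapped_sequence] applies; the
conclusion for small balls gives convergence, and for the ball of the
Kurdyka-Lojasiewicz neighborhood it gives summability. *)
Lemma KL_finite_length (Psi : 'cV[R]_N -> \bar R) (w : nat -> 'cV[R]_N) u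
    (F d s : nat -> R) (Fs c b th p B : R) :
  0 < c -> 0 <= b -> 0 <= th < 1 -> 0 <= p -> 0 <= B ->
  (forall k, 0 <= d k) -> (forall k, 0 <= s k) ->
  (forall k, Psi (w k) = (F k)%:E) -> Psi u = Fs%:E ->
  (forall k, F k.+1 + c * d k.+1 ^+ 2 <= F k) ->
  (forall k, exists2 v, frechet_subdiff Psi (w k.+1) v &
     enorm v <= b * (d k.+1 + s k.+1 + s k)) ->
  (forall k, s k.+1 <= th * s k + p * (d k.+1 + d k)) ->
  (forall k, enorm (w k.+1 - w k) <= B * (d k.+1 + s k.+1 + d k + s k)) ->
  (forall k, Fs <= F k) -> F @ \oo --> Fs ->
  d @ \oo --> (0 : R) -> s @ \oo --> (0 : R) ->
  (forall (e : R) K, 0 < e -> exists2 k, (K <= k)%N & enorm (w k - u) < e) ->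
  KL_at Psi u ->
  w @ \oo --> u /\ exists M, forall n, \sum_(0 <= k < n) (d k + s k) <= M.
Proof.
move=> c0 b0 /andP[th0 th1] p0 B0 d0 s0 PsiF Psiu desc subg recs stepw FsF Fcvg dcvg scvg clu.
move=> [eta [U [phi [eta0 /nbhs_enormP[r r0 rU] dphi kl]]]].
have phige t : 0 <= t -> (t%:E < eta)%E -> 0 <= phi t.
  by move=> t0 teta; case: dphi => -[H _ _] _ _; exact: H.
pose be := (4 * (p + 1))^-1.
have be0 : 0 < be by rewrite invr_gt0 mulr_gt0 // ltr_wpDl.
have beE : be * p = 1 / 4 - be.
  have : be * (4 * (p + 1)) = 1 by rewrite mulVf // gt_eqF // mulr_gt0 // ltr_wpDl.
  lra.
have bep : 0 <= be * p by rewrite mulr_ge0 // ltW.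
pose ga := be * (1 - th) / 2.
have dl0 : 0 < be * (1 - th) by rewrite mulr_gt0 // subr_gt0.
have ga0 : 0 < ga by rewrite divr_gt0.
pose kap := be * (1 - th) / 16 / (b + 1).
have b1 : 0 < b + 1 by lra.
have kap0 : 0 < kap by rewrite !divr_gt0.
pose q := (3 + th) / 4.
pose C := 2 * (4 * c * kap)^-1.
have ck : 0 < 4 * c * kap by apply: mulr_gt0 => //; apply: mulr_gt0.
have C0 : 0 <= C by apply: mulr_ge0 => //; rewrite invr_ge0; exact: ltW.
pose E k := d k.+1 + be * s k.+1 + ga * s k.
have E0 k : 0 <= E k.
  by apply: addr_ge0; [apply: addr_ge0|] => //; apply: mulr_ge0 => //; exact: ltW.
pose f k := phi (F k.+1 - Fs).
pose D k := enorm (w k.+1 - u).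
have stepE k : (((F k.+1 - Fs)%:E) < eta)%E -> D k < r ->
    E k.+1 <= q * E k + C * (f k - f k.+1).
  move=> Feta Dr.
  have [v Fv vb] := subg k.
  (* [b + 1] instead of [b], so that one can divide by it *)
  pose G := (b + 1) * (d k.+1 + s k.+1 + s k).
  have t0 : 0 <= d k.+1 + s k.+1 + s k by rewrite !addr_ge0.
  have klk : 0 < F k.+1 - Fs -> 1 <= derive1 phi (F k.+1 - Fs) * G.
    move=> Fp; have P0 : 0 < derive1 phi (F k.+1 - Fs) by case: dphi => _ _ /(_ _ Fp Feta)[].
    apply: (KL_ineq_subgradient P0 _ Fv); last first.
      by apply: (le_trans vb); rewrite ler_wpM2r // lerDl.
    have := kl (w k.+1) (rU _ Dr); rewrite Psiu PsiF -EFinB /=; apply.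
    - by rewrite lte_fin -subr_gt0.
    - by rewrite -lteBlDl // -EFinB.
  have key : d k.+2 <= kap * G + (4 * c * kap)^-1 * (f k - f k.+1).
    apply: (KL_step_length dphi) => //; first exact: mulr_ge0 (ltW b1) t0.
    - by rewrite subr_ge0.
    - by have := desc k.+1; lra.
  have GE : kap * G = be * (1 - th) / 16 * (d k.+1 + s k.+1 + s k).
    by rewrite /kap /G mulrA divfK // gt_eqF.
  rewrite GE in key; rewrite /E /C /ga /q.
  exact: two_step_contraction (recs k.+1).
have be1 : be <= 1 by lra.
have Ege k : be * (d k.+1 + s k.+1) <= E k.
  rewrite mulrDr /E -addrA lerD //; first by rewrite ler_piMl.
  by rewrite lerDl mulr_ge0 // ltW.
pose B' := B / be.
have B'0 : 0 <= B' by rewrite divr_ge0 // ltW.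
have stepD k : D k.+1 <= D k + B' * (E k + E k.+1).
  have -> : D k.+1 = enorm ((w k.+1 - u) + (w k.+2 - w k.+1)).
    by congr enorm; rewrite [in RHS]addrC addrA subrK.
  apply: (le_trans (ler_enormD _ _)); rewrite lerD2l.
  apply: (le_trans (stepw k.+1)); rewrite /B' -mulrA ler_wpM2l //.
  rewrite ler_pdivlMl //.
  by move: (E k) (E k.+1) (Ege k) (Ege k.+1) => e1 e2; clear; lra.
have Fsmall (e : R) : 0 < e -> \forall k \near \oo, F k.+1 - Fs < e.
  move=> e0; have /cvgrPdist_lt/(_ e e0)[K _ H] := Fcvg.
  exists K => // k /= Kk; have := H k.+1; rewrite /= (leq_trans Kk) // => /(_ isT).
  by rewrite distrC; apply: le_lt_trans (ler_norm _).
have Feta : \forall k \near \oo, ((F k.+1 - Fs)%:E < eta)%E.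
  case: (eta) eta0 => [e|_|//]; last by apply: nearW => k; rewrite ltry.
  by rewrite lte_fin => /Fsmall; apply: filterS => k; rewrite lte_fin.
have f0 k : ((F k.+1 - Fs)%:E < eta)%E -> 0 <= f k.
  by apply: phige; rewrite subr_ge0.
have fcvg : f @ \oo --> (0 : R).
  apply/cvgrPdist_lt => e e0.
  have [del del0 H] := desingularizing_cvg0 eta0 dphi e0.
  apply: filterS2 (Fsmall _ del0) Feta => k h1 h2.
  rewrite sub0r normrN ger0_norm ?f0 //; apply: H => //.
  by rewrite subr_ge0.
have Ecvg : E @ \oo --> (0 : R).
  rewrite (_ : (0 : R) = 0 + be * 0 + ga * 0); last by rewrite !mulr0 !addr0.
  have d1 : (fun k => d k.+1) @ \oo --> (0 : R) by rewrite (cvg_shiftS d).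
  have s1 : (fun k => s k.+1) @ \oo --> (0 : R) by rewrite (cvg_shiftS s).
  apply: cvgD; first (apply: cvgD => //).
    by apply: cvgM => //; exact: cvg_cst.
  by apply: cvgM => //; exact: cvg_cst.
pose M := 2 * B' / (1 - q) + B'.
have Mcvg : (fun k => M * (E k + C * f k)) @ \oo --> (0 : R).
  rewrite (_ : (0 : R) = M * (0 + C * 0)); last by rewrite mulr0 addr0 mulr0.
  apply: cvgM; first exact: cvg_cst.
  by apply: cvgD => //; apply: cvgM => //; exact: cvg_cst.
have q1 : q < 1 by rewrite /q; lra.
have trap (e : R) : 0 < e -> e <= r -> exists K, forall j, D (K + j)%N < e /\
    (1 - q) * (\sum_(0 <= i < j) E (K + i)%N) <= E K + C * f K.
  move=> e0 er; have e2 : 0 < e / 2 by rewrite divr_gt0.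
  have /cvgrPdist_lt/(_ _ e2)[K1 _ H1] := Mcvg.
  have [K2 _ H2] := Feta.
  have [[//|K] KK DK] := clu (e / 2) (maxn K1 K2).+1 e2.
  move: KK; rewrite ltnS geq_max => /andP[K1K K2K].
  exists K; apply: (trapped_sequence (C := C) (B := B') (f := f) q1) => //.
  - by move=> k Kk; apply: f0; apply: H2; rewrite /= (leq_trans K2K).
  - move=> k Kk Dk; apply: stepE; last exact: lt_le_trans Dk er.
    by apply: H2; rewrite /= (leq_trans K2K).
  - have := H1 K K1K; rewrite sub0r normrN => /(le_lt_trans (ler_norm _)).
    by move: DK; rewrite -/(D K) -/M; lra.
split.
  apply/cvg_enormP => e e0.
  have [||K HK] := trap (Num.min e r); [by rewrite lt_min e0|by rewrite ge_min lexx orbT|].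
  exists K.+1 => // -[//|k] /=; rewrite ltnS => Kk.
  have [] := HK (k - K)%N; rewrite subnKC // => Dk _.
  by apply: lt_le_trans Dk _; rewrite ge_min lexx.
have [K HK] := trap r r0 (lexx r).
pose X := E K + C * f K.
exists (\sum_(0 <= k < K.+1) (d k + s k) + X / (1 - q) / be) => n.
have ds0 k : 0 <= d k + s k by rewrite addr_ge0.
apply: (@le_trans _ _ (\sum_(0 <= k < K.+1 + n) (d k + s k))).
  rewrite addnC [leRHS](big_cat_nat (n := n)) ?leq_addr //= lerDl.
  exact: sumr_ge0.
rewrite [leLHS](big_cat_nat (n := K.+1)) ?leq_addr //= lerD2l.
rewrite -{1}[K.+1]add0n big_addn addKn.
rewrite ler_pdivlMr // mulr_suml ler_pdivlMr ?subr_gt0 // mulrC.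
have [_] := HK n; apply: le_trans; apply: ler_wpM2l; first by rewrite subr_ge0 ltW.
apply: ler_sum => i _; rewrite addnS addnC mulrC; exact: Ege.
Qed.

End FiniteLength.

(** * Quadratic forms and limits of vector sequences *)

Section QuadraticForms.
Context {R : realType}.

Lemma enorm_sqrD {N} (u v : 'cV[R]_N) :
  enorm (u + v) ^+ 2 = enorm u ^+ 2 + 2 * inner u v + enorm v ^+ 2.
Proof. by rewrite !enorm_sqr !innerE (innerC v u); ring. Qed.

Lemma wnorm2_le {N} (M : 'M[R]_N) u : wnorm2 M u <= opnorm M * enorm u ^+ 2.
Proof.
rewrite /wnorm2 (le_trans (cauchy_schwarz _ _)) // expr2 mulrA.
by rewrite ler_wpM2r ?enorm_ge0 ?enorm_mulmx_le.
Qed.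

Lemma wnorm2D {N} (M : 'M[R]_N) u v : M^T = M ->
  wnorm2 M (u + v) = wnorm2 M u + 2 * inner (M *m u) v + wnorm2 M v.
Proof.
move=> MT; rewrite /wnorm2 mulmxDr !innerE (inner_mulmx M v u) MT (innerC v).
by ring.
Qed.

Lemma inner_col_mx {p q} (u u' : 'cV[R]_p) (v v' : 'cV[R]_q) :
  inner (col_mx u v) (col_mx u' v') = inner u u' + inner v v'.
Proof.
rewrite /inner big_split_ord /=; congr (_ + _); apply: eq_bigr => i _.
  by rewrite !col_mxEu.
by rewrite !col_mxEd.
Qed.

Lemma enorm_col_mx_sqr {p q} (u : 'cV[R]_p) (v : 'cV[R]_q) :
  enorm (col_mx u v) ^+ 2 = enorm u ^+ 2 + enorm v ^+ 2.
Proof. by rewrite !enorm_sqr inner_col_mx. Qed.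

Lemma enorm_col_mx_le {p q} (u : 'cV[R]_p) (v : 'cV[R]_q) :
  enorm (col_mx u v) <= enorm u + enorm v.
Proof.
rewrite -ler_sqr ?nnegrE ?addr_ge0 ?enorm_ge0 // enorm_col_mx_sqr sqrrD.
by rewrite lerD2r lerDl mulrn_wge0 // mulr_ge0 ?enorm_ge0.
Qed.

Lemma enorm_usubmx_le {p q} (u : 'cV[R]_(p + q)) : enorm (usubmx u) <= enorm u.
Proof.
rewrite -ler_sqr ?nnegrE ?enorm_ge0 // -[in leRHS](vsubmxK u) enorm_col_mx_sqr.
by rewrite lerDl sqr_ge0.
Qed.

Lemma enorm_dsubmx_le {p q} (u : 'cV[R]_(p + q)) : enorm (dsubmx u) <= enorm u.
Proof.
rewrite -ler_sqr ?nnegrE ?enorm_ge0 // -[in leRHS](vsubmxK u) enorm_col_mx_sqr.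
by rewrite lerDr sqr_ge0.
Qed.

End QuadraticForms.

Section SequenceLimits.
Context {R : realType}.

Lemma cvg_inner {N} (us vs : nat -> 'cV[R]_N) u v :
  us @ \oo --> u -> vs @ \oo --> v ->
  (fun k => inner (us k) (vs k)) @ \oo --> inner u v.
Proof.
move=> usu vsv; apply: cvg_big => [|i _]; first exact: add_continuous.
apply: cvgM; [have H := usu|have H := vsv].
  exact: (continuous_cvg _ (@coord_continuous R N 1 i 0 u) H).
exact: (continuous_cvg _ (@coord_continuous R N 1 i 0 v) H).
Qed.

Lemma cvg_enorm {N} (us : nat -> 'cV[R]_N) u :
  us @ \oo --> u -> (fun k => enorm (us k)) @ \oo --> enorm u.
Proof.
by move=> usu; exact: (continuous_cvg _ (@sqrt_continuous R (inner u u)) (cvg_inner usu usu)).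
Qed.

Lemma cvg_enorm_le {N} (us : nat -> 'cV[R]_N) u (e : nat -> R) :
  (forall k, enorm (us k - u) <= e k) -> e @ \oo --> (0 : R) -> us @ \oo --> u.
Proof.
move=> use e0; apply/cvg_enorm0P; apply: (squeeze_cvgr _ (cvg_cst 0) e0).
by apply: nearW => k; rewrite enorm_ge0 use.
Qed.

Lemma cvg_mulmx {p q} (M : 'M[R]_(p, q)) (us : nat -> 'cV[R]_q) (u : 'cV[R]_q) :
  us @ \oo --> u -> (fun k => M *m us k) @ \oo --> M *m u.
Proof.
move=> /cvg_enorm0P usu; apply: (@cvg_enorm_le _ _ _ (fun k => opnorm M * enorm (us k - u))).
  by move=> k; rewrite -mulmxBr enorm_mulmx_le.
by rewrite -(mulr0 (opnorm M)); apply: cvgM => //; exact: cvg_cst.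
Qed.

Lemma cvg_usubmx {p q} (us : nat -> 'cV[R]_(p + q)) (u : 'cV[R]_(p + q)) :
  us @ \oo --> u -> (fun k => usubmx (us k)) @ \oo --> usubmx u.
Proof.
move=> /cvg_enorm0P; apply: cvg_enorm_le => k.
by rewrite -linearB enorm_usubmx_le.
Qed.

Lemma cvg_dsubmx {p q} (us : nat -> 'cV[R]_(p + q)) (u : 'cV[R]_(p + q)) :
  us @ \oo --> u -> (fun k => dsubmx (us k)) @ \oo --> dsubmx u.
Proof.
move=> /cvg_enorm0P; apply: cvg_enorm_le => k.
by rewrite -linearB enorm_dsubmx_le.
Qed.

Lemma cvg_real_unique (f : nat -> R) (a b : R) :
  f @ \oo --> a -> f @ \oo --> b -> a = b.
Proof.
by move=> /(cvg_lim (@Rhausdorff R)) <- /(cvg_lim (@Rhausdorff R)) <-.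
Qed.

Lemma cvg_vec_unique N (f : nat -> 'cV[R]_N) (a b : 'cV[R]_N) :
  f @ \oo --> a -> f @ \oo --> b -> a = b.
Proof.
move=> fa fb; apply/eqP; rewrite -subr_eq0; apply/eqP/enorm0_eq0.
apply: (@cvg_real_unique (fun k => enorm (f k - f k))).
  by apply: cvg_enorm; apply: cvgB.
by rewrite (_ : (fun k => _) = fun=> 0); [exact: cvg_cst|apply/funext => k; rewrite subrr enorm0].
Qed.

Lemma cvg_vanishing_diff N (us vs : nat -> 'cV[R]_N) (a : 'cV[R]_N) :
  us @ \oo --> a -> (fun j => us j - vs j) @ \oo --> (0 : 'cV[R]_N) -> vs @ \oo --> a.
Proof.
move=> ua d0; rewrite (_ : vs = us - (fun j => us j - vs j)); last first.
  by apply/funext => j; rewrite !fctE opprB addrC subrK.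
by rewrite -[a]subr0; exact: cvgB.
Qed.

Lemma cvg_vecD N (us vs : nat -> 'cV[R]_N) (a b : 'cV[R]_N) :
  us @ \oo --> a -> vs @ \oo --> b -> (fun j => us j + vs j) @ \oo --> a + b.
Proof. by move=> ua vb; exact: cvgD. Qed.

Lemma cvg_vecB N (us vs : nat -> 'cV[R]_N) (a b : 'cV[R]_N) :
  us @ \oo --> a -> vs @ \oo --> b -> (fun j => us j - vs j) @ \oo --> a - b.
Proof. by move=> ua vb; exact: cvgB. Qed.

Lemma cvg_vecZ N (c : R) (us : nat -> 'cV[R]_N) (a : 'cV[R]_N) :
  us @ \oo --> a -> (fun j => c *: us j) @ \oo --> c *: a.
Proof. by move=> ua; apply: cvgZ => //; exact: cvg_cst. Qed.

Lemma cvg_subseq {T : topologicalType} (us : nat -> T) (l : nat -> nat) (u : T) :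
  (forall j, (j <= l j)%N) -> us @ \oo --> u -> (us \o l) @ \oo --> u.
Proof.
move=> lj usu S /usu [K _ KS].
by exists K => // j /= Kj; apply: KS; rewrite /= (leq_trans Kj).
Qed.

End SequenceLimits.

(** * The regularized augmented Lagrangian *)

Section GramMatrix.
Context {R : realType} {n m : nat} (A : 'M[R]_(m, n)).

Lemma inner_gram w : inner (A *m A^T *m w) w = enorm (A^T *m w) ^+ 2.
Proof. by rewrite -mulmxA inner_mulmx -enorm_sqr. Qed.

Lemma gram_psd : symmetric_psd (A *m A^T).
Proof.
split; first by rewrite trmx_mul trmxK.
by move=> w; rewrite /wnorm2 inner_gram mul0mx inner0l sqr_ge0.
Qed.

Lemma lamA_enorm_le w : lamA A * enorm w ^+ 2 <= enorm (A^T *m w) ^+ 2.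
Proof. by rewrite -inner_gram enorm_sqr; apply: lambda_min_le gram_psd. Qed.

Lemma lamA_ge0 : 0 <= lamA A.
Proof. exact: lambda_min_ge0 gram_psd. Qed.

End GramMatrix.

Section StackedSubgradient.
Context {R : realType} {n m : nat}.

Definition stack (x : 'cV[R]_n) (z y : 'cV[R]_m) (x' : 'cV[R]_n) (y' : 'cV[R]_m) :
  'cV[R]_(n + (m + (m + (n + m)))) :=
  col_mx x (col_mx z (col_mx y (col_mx x' y'))).

Lemma stackB x z y x' y' a b c a' c' :
  stack x z y x' y' - stack a b c a' c' =
  stack (x - a) (z - b) (y - c) (x' - a') (y' - c').
Proof. by rewrite /stack !opp_col_mx !add_col_mx. Qed.

Lemma inner_stack x z y x' y' a b c a' c' :
  inner (stack x z y x' y') (stack a b c a' c') =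
  inner x a + inner z b + inner y c + inner x' a' + inner y' c'.
Proof. by rewrite !inner_col_mx !addrA. Qed.

Lemma enorm_stack_le x z y x' y' :
  enorm (stack x z y x' y') <= enorm x + enorm z + enorm y + enorm x' + enorm y'.
Proof.
rewrite -!addrA; do 4 (apply: (le_trans (enorm_col_mx_le _ _)); rewrite lerD2l).
exact: lexx.
Qed.

Lemma stackK (v : 'cV[R]_(n + (m + (m + (n + m))))) :
  v = stack (usubmx v) (usubmx (dsubmx v)) (usubmx (dsubmx (dsubmx v)))
        (usubmx (dsubmx (dsubmx (dsubmx v)))) (dsubmx (dsubmx (dsubmx (dsubmx v)))).
Proof. by rewrite /stack !vsubmxK. Qed.

Context (alg : algorithm) (g : 'cV[R]_m -> \bar R) (h : 'cV[R]_n -> R).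
Context (A : 'M[R]_(m, n)) (L r rho : R) (M1 : nat -> 'M[R]_n).

Local Notation T1 := (T1 A r rho).
Local Notation C1 := (C1 alg A L r rho M1).
Local Notation Psi := (reg_aug_lagrangian_stacked alg g h A L r rho M1).

(** The finite part of the regularized augmented Lagrangian: all of it but [g]. *)
Definition reg_real (x : 'cV[R]_n) (z y : 'cV[R]_m) (x' : 'cV[R]_n) (y' : 'cV[R]_m) : R :=
  h x + inner y (A *m x - z) + r / 2 * enorm (A *m x - z) ^+ 2
  + (T1 * enorm (A^T *m (y - y')) ^+ 2 + C1 / 2 * enorm (x - x') ^+ 2).

Lemma Psi_stack x z y x' y' :
  Psi (stack x z y x' y') = (g z + (reg_real x z y x' y')%:E)%E.
Proof.
rewrite /reg_aug_lagrangian_stacked /stack !(col_mxKu, col_mxKd).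
by rewrite /reg_aug_lagrangian /aug_lagrangian -addeA -EFinD.
Qed.

(** The gradient of [reg_real], plus a subgradient [p] of [g] in the [z]-block. *)
Definition reg_grad x z y x' y' (p : 'cV[R]_m) :=
  stack (gradient h x + A^T *m y + r *: (A^T *m (A *m x - z)) + C1 *: (x - x'))
    (p - y - r *: (A *m x - z))
    (A *m x - z + (2 * T1) *: (A *m (A^T *m (y - y'))))
    (- (C1 *: (x - x')))
    (- ((2 * T1) *: (A *m (A^T *m (y - y'))))).

Let quadratic_remainder_ge (k1 k2 k3 i j mb hh bb t1 t2 ea eb ec ea' ec' : R) :
  0 <= k1 -> 0 <= k2 -> 0 <= k3 ->
  0 <= ea -> 0 <= eb -> 0 <= ec -> 0 <= ea' -> 0 <= ec' ->
  mb <= k1 * eb -> - (k2 * ea) <= hh -> - k3 * ec <= bb -> 0 <= t1 -> 0 <= t2 ->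
  i + j - (k1 + k2 + k3) * (ea + eb + ec + ea' + ec')
    <= j - mb + (i + hh + (bb + t1 + t2)).
Proof.
move=> K1 K2 K3 a0 b0 c0 a'0 c'0 m1 hb bil q1 q2.
have := mulr_ge0 K1 a0; have := mulr_ge0 K1 c0; have := mulr_ge0 K1 a'0.
have := mulr_ge0 K1 c'0; have := mulr_ge0 K2 b0; have := mulr_ge0 K2 c0.
have := mulr_ge0 K2 a'0; have := mulr_ge0 K2 c'0; have := mulr_ge0 K3 a0.
have := mulr_ge0 K3 b0; have := mulr_ge0 K3 a'0; have := mulr_ge0 K3 c'0.
lra.
Qed.

Context (hdiff : forall w, differentiable h w).
Context (hlip : forall w w', enorm (gradient h w - gradient h w') <= L * enorm (w - w')).
Context (r0 : 0 < r) (T1_ge0 : 0 <= T1) (C1_ge0 : 0 <= C1).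

(** Apart from [h], the function is a quadratic polynomial, and its expansion is
exact. *)
Lemma reg_real_expand x z y x' y' a b c a' c' :
  reg_real (x + a) (z + b) (y + c) (x' + a') (y' + c') =
  reg_real x z y x' y'
  + inner (reg_grad x z y x' y' 0) (stack a b c a' c')
  + (h (x + a) - h x - inner (gradient h x) a)
  + (inner c (A *m a - b) + r / 2 * enorm (A *m a - b) ^+ 2
     + T1 * enorm (A^T *m (c - c')) ^+ 2 + C1 / 2 * enorm (a - a') ^+ 2).
Proof.
have e1 : A *m (x + a) - (z + b) = (A *m x - z) + (A *m a - b).
  by rewrite mulmxDr opprD addrACA.
have e2 : A^T *m (y + c - (y' + c')) = A^T *m (y - y') + A^T *m (c - c').
  by rewrite -mulmxDr opprD addrACA.
have e3 : x + a - (x' + a') = (x - x') + (a - a') by rewrite opprD addrACA.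
rewrite /reg_real e1 e2 e3 !enorm_sqrD inner_stack.
have adj w : inner (A^T *m w) a = inner w (A *m a - b) + inner w b.
  by rewrite inner_mulmx trmxK innerDr innerNr subrK.
move: (A *m x - z) (A *m a - b) (y - y') (x - x') adj => e ea f dd adj.
rewrite !(innerDl, innerNl, innerZl) inner0l !(innerDr _ e ea) !adj.
have -> : inner (A *m (A^T *m f)) c = inner (A^T *m f) (A^T *m c) by rewrite inner_mulmx.
have -> : inner (A *m (A^T *m f)) c' = inner (A^T *m f) (A^T *m c') by rewrite inner_mulmx.
rewrite (_ : inner (A^T *m f) (A^T *m (c - c')) =
  inner (A^T *m f) (A^T *m c) - inner (A^T *m f) (A^T *m c')); last first.
  by rewrite mulmxBr innerDr innerNr.
rewrite !(innerDr dd) (innerNr dd) (innerC c e).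
by field.
Qed.

(** In the expansion the only second order terms of indefinite sign come from [g],
from [h] and from the coupling [inner c (A *m a - b)]; the penalty
[r / 2 * enorm (A *m a - b) ^+ 2] completes the coupling to a square, up to
[- (2 * r)^-1 * enorm c ^+ 2].  The total is thus bounded below by a quadratic. *)
Lemma reg_lagrangian_frechet x z y x' y' p (Cz : R) :
  g z \is a fin_num ->
  (forall b, (g z + (inner p b - Cz * enorm b ^+ 2)%:E <= g (z + b))%E) ->
  frechet_subdiff Psi (stack x z y x' y') (reg_grad x z y x' y' p).
Proof.
move=> gz gp.
have LC : 0 <= `|Cz| + `|L| / 2 + (2 * r)^-1.
  by rewrite !addr_ge0 ?divr_ge0 // invr_ge0 mulr_ge0 // ltW.
apply: (@proximal_frechet_subdiff _ _ _ _ _ (`|Cz| + `|L| / 2 + (2 * r)^-1)).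
  by rewrite Psi_stack fin_numD gz.
move=> v; rewrite (stackK v).
move: (usubmx v) (usubmx (dsubmx v)) (usubmx (dsubmx (dsubmx v)))
  (usubmx (dsubmx (dsubmx (dsubmx v)))) (dsubmx (dsubmx (dsubmx (dsubmx v)))).
clear v => vx vz vy vx' vy'; rewrite stackB !Psi_stack.
pose a := vx - x; pose b := vz - z; pose c := vy - y.
pose a' := vx' - x'; pose c' := vy' - y'.
rewrite -/a -/b -/c -/a' -/c'.
have := gp b; rewrite -(fineK gz); set gz' := fine (g z).
have -> : vz = z + b by rewrite addrC subrK.
have -> : vx = x + a by rewrite addrC subrK.
have -> : vy = y + c by rewrite addrC subrK.
have -> : vx' = x' + a' by rewrite addrC subrK.
have -> : vy' = y' + c' by rewrite addrC subrK.
rewrite reg_real_expand.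
have gE : inner (reg_grad x z y x' y' p) (stack a b c a' c')
    = inner (reg_grad x z y x' y' 0) (stack a b c a' c') + inner p b.
  by rewrite !inner_stack !(innerDl, innerNl) inner0l; ring.
rewrite gE.
have nE : enorm (stack a b c a' c') ^+ 2 =
    enorm a ^+ 2 + enorm b ^+ 2 + enorm c ^+ 2 + enorm a' ^+ 2 + enorm c' ^+ 2.
  by rewrite !enorm_sqr inner_stack.
rewrite nE.
have hb := quadratic_bound x a hdiff hlip.
have bil : - (2 * r)^-1 * enorm c ^+ 2 <= inner c (A *m a - b) + r / 2 * enorm (A *m a - b) ^+ 2.
  have : 0 <= r / 2 * enorm (A *m a - b + r^-1 *: c) ^+ 2.
    by rewrite mulr_ge0 ?sqr_ge0 // divr_ge0 // ltW.
  rewrite enorm_sqrD innerZr enormZ (innerC _ c) gtr0_norm ?invr_gt0 // exprMn.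
  have -> : (2 * r)^-1 = r / 2 * r^-1 ^+ 2 by field; rewrite gt_eqF.
  move: (inner c _) (enorm _ ^+ 2) (enorm c ^+ 2) => i e1 e2.
  have -> : r / 2 * (e1 + 2 * (r^-1 * i) + r^-1 ^+ 2 * e2) =
    r / 2 * e1 + i + r / 2 * r^-1 ^+ 2 * e2 by field; rewrite gt_eqF.
  by lra.
have q1 : 0 <= T1 * enorm (A^T *m (c - c')) ^+ 2 by rewrite mulr_ge0 ?sqr_ge0.
have q2 : 0 <= C1 / 2 * enorm (a - a') ^+ 2 by rewrite mulr_ge0 ?sqr_ge0 ?divr_ge0.
have s0 : forall k (w : 'cV[R]_k), 0 <= enorm w ^+ 2 by move=> k w; rewrite sqr_ge0.
have m1 : Cz * enorm b ^+ 2 <= `|Cz| * enorm b ^+ 2 by rewrite ler_wpM2r ?ler_norm.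
have m2 : L / 2 * enorm a ^+ 2 <= `|L| / 2 * enorm a ^+ 2.
  by rewrite ler_wpM2r // ler_wpM2r ?ler_norm.
have key : inner (reg_grad x z y x' y' 0) (stack a b c a' c') + inner p b
    - (`|Cz| + `|L| / 2 + (2 * r)^-1)
      * (enorm a ^+ 2 + enorm b ^+ 2 + enorm c ^+ 2 + enorm a' ^+ 2 + enorm c' ^+ 2)
    <= inner p b - Cz * enorm b ^+ 2
      + (inner (reg_grad x z y x' y' 0) (stack a b c a' c')
      + (h (x + a) - h x - inner (gradient h x) a)
      + (inner c (A *m a - b) + r / 2 * enorm (A *m a - b) ^+ 2
     + T1 * enorm (A^T *m (c - c')) ^+ 2 + C1 / 2 * enorm (a - a') ^+ 2)).
  move: hb; rewrite ler_norml => /andP[hb _].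
  apply: quadratic_remainder_ge => //.
  - by rewrite invr_ge0 mulr_ge0 // ltW.
  - by apply: le_trans hb; rewrite lerN2.
case: (g (z + b)) => [gb| |] /=.
- rewrite !lee_fin => gineq.
  lra.
- by move=> _; rewrite addye // leey.
- by rewrite leeNy_eq.
Qed.

End StackedSubgradient.

(** * Descent and subgradient estimates along the iterates *)

Section Iterates.
Context {R : realType} {n m : nat} (alg : algorithm).
Context (g : 'cV[R]_m -> \bar R) (h : 'cV[R]_n -> R) (A : 'M[R]_(m, n)).
Context (L r rho : R) (M1 : nat -> 'M[R]_n) (M2 : nat -> 'M[R]_m).
Context (x : nat -> 'cV[R]_n) (z y : nat -> 'cV[R]_m).
Context (Hset : setting g h L r rho M1 M2).
Context (HA : assumption_A alg g h A L r rho M1 M2).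
Context (Hgen : generated alg g h A r rho M1 M2 x z y).

Local Notation lam := (lamA A).
Local Notation T0 := (T0 A rho).
Local Notation T1 := (T1 A r rho).
Local Notation mu := (mu1 M1).
Local Notation C1 := (C1 alg A L r rho M1).
Local Notation C_M := (C_M alg A L rho M1).
Local Notation Psi := (reg_aug_lagrangian_stacked alg g h A L r rho M1).

Let r0 : 0 < r. Proof. by case: Hset => _ _ _ []. Qed.
Let rho0 : 0 < rho. Proof. by case: Hset => _ _ _ [_ /andP[]]. Qed.
Let rho2 : rho < 2. Proof. by case: Hset => _ _ _ [_ /andP[]]. Qed.
Let rhor0 : 0 < rho * r. Proof. exact: mulr_gt0. Qed.
Let hdiff w : differentiable h w. Proof. by case: Hset => _ []. Qed.
Let hlip w w' : enorm (gradient h w - gradient h w') <= L * enorm (w - w').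
Proof. by case: Hset => _ []. Qed.
Let M1psd k : symmetric_psd (M1 k). Proof. by case: Hset => _ _ []. Qed.
Let M2psd k : symmetric_psd (M2 k). Proof. by case: Hset => _ _ []. Qed.

(** For a singular [A *m A^T] the constant [T0] would be a quotient by 0, hence 0,
contrary to [0 < 4 * T0 * L]. *)
Lemma lam_gt0 : 0 < lam.
Proof.
rewrite lt_neqAle lamA_ge0 andbT; apply/eqP => lam0.
case: HA => _ _ _ [_ + _]; rewrite /Defs.T0 -lam0 !mul0r invr0 !mulr0.
by case: ifP; rewrite mulr0 mul0r ltxx.
Qed.

Lemma T0_gt0 : 0 < T0.
Proof.
have l0 := lam_gt0; have rho2' : 0 < 2 - rho by rewrite subr_gt0.
rewrite /Defs.T0; case: ifP => _; apply: divr_gt0 => //; apply: mulr_gt0 => //.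
exact: exprn_gt0.
Qed.

Lemma L_gt0 : 0 < L.
Proof.
case: HA => _ _ _ [_ + _]; rewrite pmulr_rgt0 // mulr_gt0 //; exact: T0_gt0.
Qed.

Lemma T1_ge0 : 0 <= T1.
Proof.
have l0 := lam_gt0; have rho2' : 0 < 2 - rho by rewrite subr_gt0.
rewrite /Defs.T1; case: ifP => rho1; apply: divr_ge0; rewrite ?subr_ge0 //.
- by apply/ltW; apply: mulr_gt0 => //; apply: mulr_gt0 => //; apply: exprn_gt0.
- by apply: ltW; rewrite ltNge rho1.
- by apply/ltW; do 3 apply: mulr_gt0 => //.
Qed.

Lemma enorm_M1_le k v : enorm (M1 k *m v) <= mu * enorm v.
Proof.
apply: (le_trans (enorm_mulmx_le _ _)); rewrite ler_wpM2r ?enorm_ge0 //.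
by case: HA => _ _ [M1b _] _; apply: ub_le_sup => //; exists k.
Qed.

Lemma mu_ge0 : 0 <= mu.
Proof.
apply: (le_trans (opnorm_ge0 (M1 0))).
by case: HA => _ _ [M1b _] _; apply: ub_le_sup => //; exists 0%N.
Qed.

(** The constants by which [xstep k.+1], respectively [xstep k], enters the bound of
[dual_target k.+1 - dual_target k].  The Lipschitz constant of the gradient goes
with the new step when the gradient is taken at the new point, and with the old
one otherwise; in terms of these weights both algorithms have the same
constants ([C1E], [C_ME]). *)
Definition lip_new : R := match alg with Alg1 => L + mu | Alg2 => mu end.
Definition lip_old : R := match alg with Alg1 => mu | Alg2 => L + mu end.

Lemma lip_new_ge0 : 0 <= lip_new.
Proof. by rewrite /lip_new; case: alg; rewrite ?addr_ge0 ?mu_ge0 // ltW // L_gt0. Qed.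

Lemma lip_old_ge0 : 0 <= lip_old.
Proof. by rewrite /lip_old; case: alg; rewrite ?addr_ge0 ?mu_ge0 // ltW // L_gt0. Qed.

Lemma lip_sum_gt0 : 0 < lip_new + lip_old.
Proof. by rewrite /lip_new /lip_old; have := L_gt0; have := mu_ge0; case: alg; lra. Qed.

Lemma C1E : C1 / 2 = 2 * T0 * lip_old ^+ 2 / r.
Proof. by rewrite /Defs.C1 /lip_old; case: alg; field; rewrite gt_eqF. Qed.

Lemma C_ME : C_M = (4 * lip_new ^+ 2 + 6 * lip_old ^+ 2) * T0.
Proof. by rewrite /Defs.C_M /lip_new /lip_old; case: alg; ring. Qed.

Lemma C1_ge0 : 0 <= C1.
Proof.
have : 0 <= C1 / 2.
  rewrite C1E divr_ge0 ?(ltW r0) // mulr_ge0 ?sqr_ge0 // mulr_ge0 // ltW //.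
  exact: T0_gt0.
by rewrite pmulr_lge0.
Qed.

(** The point at which the gradient enters the optimality condition of the
[x]-step. *)
Definition xgrad k : 'cV[R]_n :=
  gradient h (match alg with Alg1 => x k.+1 | Alg2 => x k end).
Definition residual k : 'cV[R]_m := A *m x k.+1 - z k.+1.
(** The vector towards which [A^T *m y] is relaxed with factor [rho]; see
[dual_step]. *)
Definition dual_target k : 'cV[R]_n := - xgrad k - M1 k *m (x k.+1 - x k).
Definition xstep k : R := enorm (x k.+1 - x k).
Definition ystep k : R := enorm (A^T *m (y k.+1 - y k)).
(** The subgradient of [g] at [z k.+1] given by the optimality of the [z]-step. *)
Definition zgrad k : 'cV[R]_m :=
  y k + r *: (A *m x k - z k.+1) - M2 k *m (z k.+1 - z k).
(** The index is shifted because [g (z 0)] may be infinite. *)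
Definition iterate k := stack (x k.+1) (z k.+1) (y k.+1) (x k) (y k).
Definition energy k : R :=
  fine (g (z k.+1)) + reg_real alg h A L r rho M1 (x k.+1) (z k.+1) (y k.+1) (x k) (y k).

Let zmin k : forall v, (z_objective g A r M2 k (x k) (z k) (y k) (z k.+1)
   <= z_objective g A r M2 k (x k) (z k) (y k) v)%E.
Proof. by case: (Hgen k). Qed.
Let xmin k : forall v, (x_objective alg h A r M1 k (x k) (z k.+1) (y k) (x k.+1)
   <= x_objective alg h A r M1 k (x k) (z k.+1) (y k) v).
Proof. by case: (Hgen k). Qed.

Lemma y_step k : y k.+1 - y k = (rho * r) *: residual k.
Proof. by case: (Hgen k) => _ _ ->; rewrite addrC addKr. Qed.

Lemma residualE k : residual k = (rho * r)^-1 *: (y k.+1 - y k).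
Proof. by rewrite y_step scalerA mulVf ?scale1r // gt_eqF. Qed.

(** The [x]-objective exceeds its linearization at the minimum by at most a
quadratic, so that [inner_quadratic_ge0_eq0] applies. *)
Lemma x_optimality k : A^T *m y k + r *: (A^T *m residual k) = dual_target k.
Proof.
apply/eqP; rewrite -subr_eq0; apply/eqP.
pose Q w := inner (y k) (A *m w - z k.+1) + r / 2 * enorm (A *m w - z k.+1) ^+ 2
    + 1 / 2 * wnorm2 (M1 k) (w - x k).
pose G0 := A^T *m y k + r *: (A^T *m residual k) + M1 k *m (x k.+1 - x k).
have QE v : Q (x k.+1 + v) = Q (x k.+1) + inner G0 v
    + (r / 2 * enorm (A *m v) ^+ 2 + 1 / 2 * wnorm2 (M1 k) v).
  rewrite /Q mulmxDr (addrAC _ (A *m v)) (addrAC _ v) enorm_sqrD innerDr.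
  rewrite wnorm2D; last by case: (M1psd k).
  rewrite /G0 /residual !innerDl innerZl !(inner_mulmx A^T) trmxK !innerDl.
  by field.
have Qb v : r / 2 * enorm (A *m v) ^+ 2 + 1 / 2 * wnorm2 (M1 k) v
    <= (r / 2 * opnorm A ^+ 2 + opnorm (M1 k) / 2) * enorm v ^+ 2.
  have h1 := wnorm2_le (M1 k) v.
  have h2 : enorm (A *m v) ^+ 2 <= opnorm A ^+ 2 * enorm v ^+ 2.
    rewrite -exprMn ler_pXn2r // ?nnegrE ?enorm_ge0 ?mulr_ge0 ?opnorm_ge0 ?enorm_ge0 //.
    exact: enorm_mulmx_le.
  have rr : 0 <= r / 2 by rewrite divr_ge0 // ltW.
  have := ler_wpM2l rr h2; move: h1.
  by move: (wnorm2 _ _) (enorm v ^+ 2) (enorm _ ^+ 2) (opnorm A ^+ 2) (opnorm _) => *; lra.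
apply: (@inner_quadratic_ge0_eq0 _ _ _
  (L / 2 + (r / 2 * opnorm A ^+ 2 + opnorm (M1 k) / 2))) => v.
have -> : A^T *m y k + r *: (A^T *m residual k) - dual_target k = xgrad k + G0.
  by rewrite /dual_target /G0 opprB opprK addrA [RHS]addrC addrAC.
pose lead w := match alg with Alg1 => h w | Alg2 => inner (w - x k) (gradient h (x k)) end.
have objE w : x_objective alg h A r M1 k (x k) (z k.+1) (y k) w = lead w + Q w.
  by rewrite /x_objective /Q /lead -!addrA.
have leadb : lead (x k.+1 + v) <= lead (x k.+1) + inner (xgrad k) v + L / 2 * enorm v ^+ 2.
  have L0 : 0 <= L / 2 * enorm v ^+ 2.
    by rewrite mulr_ge0 ?sqr_ge0 // divr_ge0 // ltW // L_gt0.
  rewrite /lead /xgrad; case: alg.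
    have := quadratic_bound (x k.+1) v hdiff hlip; rewrite ler_norml => /andP[_].
    by move: (h _) (h _) (inner _ _) (L / 2 * _) => *; lra.
  by rewrite (addrAC (x k.+1) v) (innerDl _ v) (innerC v) lerDl.
have := xmin k (x k.+1 + v); rewrite !objE QE (innerDl _ G0) mulrDl.
by move: leadb (Qb v); lra.
Qed.

(** The same inequality for both algorithms: it is expanded at [x k.+1] or at
[x k], wherever the gradient is taken. *)
Lemma h_step k :
  h (x k.+1) <= h (x k) + inner (xgrad k) (x k.+1 - x k) + L / 2 * xstep k ^+ 2.
Proof.
rewrite /xgrad /xstep; case: alg.
  have := quadratic_bound (x k.+1) (x k - x k.+1) hdiff hlip; rewrite ler_norml => /andP[+ _].
  rewrite (addrC (x k.+1)) subrK enormB -(opprB (x k.+1)) innerNr.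
  by move: (h _) (h _) (inner _ _) (L / 2 * _) => *; lra.
have := quadratic_bound (x k) (x k.+1 - x k) hdiff hlip; rewrite ler_norml => /andP[_].
rewrite (addrC (x k)) subrK.
by move: (h _) (h _) (inner _ _) (L / 2 * _) => *; lra.
Qed.

Let feas (w v : 'cV[R]_m) := inner v w + r / 2 * enorm w ^+ 2.

(** The expansion of the quadratic part at [x k.+1] and the optimality condition
leave the form of [2 *: M1 k + r *: (A^T *m A) - L] as the gain, to which the
standing assumption applies. *)
Lemma x_step k :
  h (x k.+1) + feas (residual k) (y k) + C_M / (2 * r) * xstep k ^+ 2
  <= h (x k) + feas (A *m x k - z k.+1) (y k).
Proof.
set e := residual k; set Dl := x k.+1 - x k.
have -> : A *m x k - z k.+1 = e - A *m Dl.
  by rewrite /e /residual /Dl mulmxBr opprB [RHS]addrC addrA subrK.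
rewrite /feas enorm_sqrD enormN !innerDr !innerNr.
have opt : inner (y k) (A *m Dl) + r * inner e (A *m Dl) =
    - inner (xgrad k) Dl - wnorm2 (M1 k) Dl.
  rewrite /wnorm2 -[LHS](_ : inner (A^T *m y k + r *: (A^T *m e)) Dl = _); last first.
    by rewrite innerDl innerZl !inner_mulmx trmxK.
  by rewrite x_optimality /dual_target innerDl !innerNl.
have := h_step k; rewrite -/Dl.
case: HA => _ _ _ [_ _ /(_ k Dl)].
rewrite /wnorm2 mul_scalar_mx innerZl -(enorm_sqr Dl) mulmxDl -!scalemxAl.
rewrite innerDl !innerZl -mulmxA (inner_mulmx A^T) trmxK -enorm_sqr -/(xstep k).
rewrite /wnorm2 in opt.
have -> : C_M / (2 * r) = C_M / r / 2 by field; rewrite gt_eqF.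
move: (C_M / r) opt; move: (h _) (h _) (inner (y k) _) (inner (y k) _) (inner e _).
move: (inner (xgrad k) _) (inner (M1 k *m Dl) _) (enorm _ ^+ 2) (enorm _ ^+ 2) (xstep k ^+ 2).
by move=> *; lra.
Qed.

Lemma gz_fin k : g (z k.+1) \is a fin_num.
Proof.
case: Hset => [[[gN [v gv]] _] _ _ _].
rewrite fin_numE gN /=; apply/eqP => gE; have := zmin k v.
rewrite /z_objective gE addye //.
by move: (gN v) gv; case: (g v) => [b| |].
Qed.

(** Minimality of [z k.+1], with the quadratic part of the objective expanded
exactly at that point. *)
Lemma z_prox k w (C := r / 2 + opnorm (M2 k) / 2) :
  (g (z k.+1) + (inner (zgrad k) w - C * enorm w ^+ 2)%:E <= g (z k.+1 + w))%E.
Proof.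
have := zmin k (z k.+1 + w); rewrite /z_objective -(fineK (gz_fin k)).
have : g (z k.+1 + w) != -oo%E by case: Hset => [[[-> _] _] _ _ _].
have eE : A *m x k - (z k.+1 + w) = (A *m x k - z k.+1) - w by rewrite opprD addrA.
rewrite eE (enorm_sqrD _ (- w)) enormN (addrAC (z k.+1) w).
rewrite (@wnorm2D _ _ (M2 k) _ w); last by case: (M2psd k).
rewrite (innerDr (y k) _ (- w)) !(innerNr _ w).
have Mb := wnorm2_le (M2 k) w.
have zE : inner (zgrad k) w = inner (y k) w + r * inner (A *m x k - z k.+1) w
   - inner (M2 k *m (z k.+1 - z k)) w.
  by rewrite /zgrad (innerDl (y k + _)) innerNl (innerDl (y k)) innerZl.
rewrite zE; case: (g (z k.+1 + w)) => [b| |//] _; last by move=> _; rewrite leey.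
rewrite !lee_fin /C; move: Mb; lra.
Qed.

Lemma dual_step k : A^T *m y k.+1 = rho *: dual_target k + (1 - rho) *: (A^T *m y k).
Proof.
rewrite -x_optimality; have -> : y k.+1 = y k + (rho * r) *: residual k by case: (Hgen k).
rewrite mulmxDr -scalemxAr scalerDr scalerA scalerBl scale1r.
by rewrite [RHS]addrAC [in RHS]addrCA subrr addr0.
Qed.

Lemma dual_difference k : A^T *m (y k.+2 - y k.+1) =
  rho *: (dual_target k.+1 - dual_target k) + (1 - rho) *: (A^T *m (y k.+1 - y k)).
Proof.
rewrite !mulmxBr; move: (dual_step k) (dual_step k.+1).
move: (A^T *m y k) (A^T *m y k.+1) (A^T *m y k.+2) => a b c Eb Ec.
by rewrite Ec [X in _ - X = _]Eb !scalerBr opprD addrACA.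
Qed.

Lemma enorm_dual_difference k :
  enorm (dual_target k.+1 - dual_target k)
    <= lip_new * xstep k.+1 + lip_old * xstep k.
Proof.
have -> : dual_target k.+1 - dual_target k = (xgrad k - xgrad k.+1)
    + (M1 k *m (x k.+1 - x k) - M1 k.+1 *m (x k.+2 - x k.+1)).
  by rewrite /dual_target opprB opprK [LHS]addrC (addrC (M1 k *m _)) addrACA.
have m1 := enorm_M1_le k (x k.+1 - x k); have m2 := enorm_M1_le k.+1 (x k.+2 - x k.+1).
apply: (le_trans (ler_enormD _ _)).
have := ler_enormB (M1 k *m (x k.+1 - x k)) (M1 k.+1 *m (x k.+2 - x k.+1)).
have : enorm (xgrad k - xgrad k.+1)
    <= L * match alg with Alg1 => xstep k.+1 | Alg2 => xstep k end.
  rewrite /xgrad /xstep enormB; case: alg; exact: hlip.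
rewrite /lip_new /lip_old -!/(xstep _) in m1 m2 *; case: alg; lra.
Qed.

Lemma ystep_rec k : ystep k.+1 <=
  `|1 - rho| * ystep k + rho * (lip_new + lip_old) * (xstep k.+1 + xstep k).
Proof.
rewrite /ystep dual_difference; apply: (le_trans (ler_enormD _ _)).
rewrite !enormZ (gtr0_norm rho0) addrC lerD2l -mulrA ler_wpM2l ?(ltW rho0) //.
apply: (le_trans (enorm_dual_difference k)); have d0 := enorm_ge0 (x k.+1 - x k).
have d1 := enorm_ge0 (x k.+2 - x k.+1); rewrite -!/(xstep _) in d0 d1.
by have := mulr_ge0 lip_new_ge0 d0; have := mulr_ge0 lip_old_ge0 d1; lra.
Qed.

Lemma enorm_dy_le k : enorm (y k.+1 - y k) <= (Num.sqrt lam)^-1 * ystep k.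
Proof.
have sl : 0 < Num.sqrt lam by rewrite sqrtr_gt0 lam_gt0.
rewrite ler_pdivlMl // -ler_sqr ?nnegrE ?enorm_ge0 ?mulr_ge0 ?enorm_ge0 ?sqrtr_ge0 //.
by rewrite exprMn sqr_sqrtr ?lamA_ge0 // lamA_enorm_le.
Qed.

(** For [rho <= 1] the argument is a convex combination of [w] and [a].  Beyond 1
it is the convex combination of [(rho / (2 - rho)) *: w] and [- a] with
weights [2 - rho] and [rho - 1]. *)
Lemma relaxed_sqr_le (w a : 'cV[R]_n) :
  if rho <= 1
  then enorm (rho *: w + (1 - rho) *: a) ^+ 2 <= rho * enorm w ^+ 2 + (1 - rho) * enorm a ^+ 2
  else enorm (rho *: w + (1 - rho) *: a) ^+ 2
         <= rho ^+ 2 / (2 - rho) * enorm w ^+ 2 + (rho - 1) * enorm a ^+ 2.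
Proof.
have rho2' : 0 < 2 - rho by rewrite subr_gt0.
rewrite !enorm_sqr !innerE (innerC a w) -!enorm_sqr.
case: ifPn => [rho1|]; last rewrite -ltNge => rho1.
  have := inner_ge0 (w - a); rewrite !innerE (innerC a w) -!enorm_sqr => H.
  have : 0 <= rho * (1 - rho) * (enorm w ^+ 2 - inner w a - inner w a + enorm a ^+ 2).
    by rewrite !mulr_ge0 ?subr_ge0 ?(ltW rho0) //; lra.
  by lra.
have := inner_ge0 (rho *: w + (2 - rho) *: a).
rewrite !innerE (innerC a w) -!enorm_sqr.
move: (enorm w ^+ 2) (enorm a ^+ 2) (inner w a) => W a2 i H.
have : 0 <= (rho - 1) / (2 - rho) * (rho * (rho * W) + (2 - rho) * (rho * i)
    + (rho * ((2 - rho) * i) + (2 - rho) * ((2 - rho) * a2))).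
  rewrite mulr_ge0 //; last by move: H; lra.
  by rewrite divr_ge0 ?subr_ge0 // ltW.
move=> H2; rewrite -subr_ge0; apply: (le_trans H2).
rewrite le_eqVlt; apply/orP; left; apply/eqP.
by field; rewrite gt_eqF.
Qed.

(** Once the difference of squares is isolated, [relaxed_sqr_le] leaves
[ystep k.+1 ^+ 2] with the coefficient [rho], respectively [2 - rho].  Dividing by
it and applying [lamA_enorm_le] produces the constants [T0] and [T1]. *)
Lemma dy_sqr_telescope k : enorm (y k.+2 - y k.+1) ^+ 2 / (rho * r) <=
  T0 / r * enorm (dual_target k.+1 - dual_target k) ^+ 2
    + T1 * (ystep k ^+ 2 - ystep k.+1 ^+ 2).
Proof.
have rho2' : 0 < 2 - rho by rewrite subr_gt0.
have l0 := lam_gt0.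
have D := lamA_enorm_le A (y k.+2 - y k.+1).
have := relaxed_sqr_le (dual_target k.+1 - dual_target k) (A^T *m (y k.+1 - y k)).
rewrite -dual_difference -/(ystep k) -/(ystep k.+1) /Defs.T0 /Defs.T1.
rewrite -/(ystep k.+1) in D.
move: (enorm _ ^+ 2) (enorm (dual_target _ - _) ^+ 2) (ystep k ^+ 2)
  (ystep k.+1 ^+ 2) D => d W S S' D.
case: ifPn => [rho1|]; last rewrite -ltNge => rho1 H.
  move=> H; rewrite -subr_ge0.
  have -> : 1 / (lam * rho) / r * W + (1 - rho) / (lam * rho ^+ 2 * r) * (S - S')
      - d / (rho * r)
     = (rho * W + (1 - rho) * (S - S') - rho * (lam * d)) / (lam * rho ^+ 2 * r).
    by field; rewrite !gt_eqF.
  rewrite divr_ge0 //; last by rewrite ltW // !mulr_gt0 // exprn_gt0.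
  by have := ler_wpM2l (ltW rho0) D; lra.
rewrite -subr_ge0.
have -> : rho / (lam * (2 - rho) ^+ 2) / r * W
    + (rho - 1) / (lam * (2 - rho) * rho * r) * (S - S') - d / (rho * r)
   = (rho ^+ 2 / (2 - rho) * W + (rho - 1) * (S - S') - (2 - rho) * (lam * d))
     / (lam * (2 - rho) * rho * r).
  by field; rewrite !gt_eqF.
rewrite divr_ge0 //; last by rewrite ltW // !mulr_gt0.
by have := ler_wpM2l (ltW rho2') D; lra.
Qed.

Lemma dual_ascent k :
  inner (y k.+1) (residual k) = inner (y k) (residual k) + enorm (y k.+1 - y k) ^+ 2 / (rho * r).
Proof.
rewrite enorm_sqr {2}y_step innerZr mulrAC mulfV ?gt_eqF // mul1r.
by rewrite innerDl innerNl addrCA subrr addr0.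
Qed.

Lemma energyE k : energy k = fine (g (z k.+1)) + (h (x k.+1) + feas (residual k) (y k)
  + enorm (y k.+1 - y k) ^+ 2 / (rho * r) + T1 * ystep k ^+ 2 + C1 / 2 * xstep k ^+ 2).
Proof.
rewrite /energy /reg_real -/(residual k) -/(ystep k) -/(xstep k); congr (_ + _).
rewrite dual_ascent.
by rewrite /feas; ring.
Qed.

Lemma z_step k : fine (g (z k.+2)) + feas (A *m x k.+1 - z k.+2) (y k.+1)
  <= fine (g (z k.+1)) + feas (residual k) (y k.+1).
Proof.
have := zmin k.+1 (z k.+1); rewrite /z_objective subrr.
have -> : wnorm2 (M2 k.+1) (0 : 'cV[R]_m) = 0 by rewrite /wnorm2 inner0r.
rewrite -(fineK (gz_fin k)) -(fineK (gz_fin k.+1)) lee_fin /feas /residual /=.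
have := wnorm2_ge0 (z k.+2 - z k.+1) (M2psd k.+1); lra.
Qed.

(** If [lip_old] vanishes, the mixed term in the square of [lip_new * xstep k.+1 +
lip_old * xstep k] is absent and need not be split, which frees a part of the
[lip_new] term; otherwise the slack is in the coefficient of [lip_old]. *)
Definition decrease : R := T0 / r * (if lip_old == 0 then lip_new ^+ 2 else lip_old ^+ 2).

Lemma decrease_gt0 : 0 < decrease.
Proof.
rewrite /decrease mulr_gt0 ?divr_gt0 ?T0_gt0 //; have w0 := lip_sum_gt0.
case: ifPn => [/eqP e|e]; first by rewrite exprn_gt0 //; move: w0; rewrite e addr0.
by rewrite exprn_gt0 // lt_neqAle eq_sym e lip_old_ge0.
Qed.

(** The sum of the three steps.  Only the dual ascent increases the Lagrangian;
by [dy_sqr_telescope] this increase is paid for by the telescoping term with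
[T1], by the term with [C1], and by the gain of the [x]-step. *)
Lemma energy_decrease k : energy k.+1 + decrease * xstep k.+1 ^+ 2 <= energy k.
Proof.
have e1 := x_step k.+1; have e2 := z_step k; have e3 := dy_sqr_telescope k.
have W := enorm_dual_difference k.
have T0r : 0 < T0 / r by rewrite divr_gt0 ?T0_gt0.
have W2 : enorm (dual_target k.+1 - dual_target k) ^+ 2
    <= (lip_new * xstep k.+1 + lip_old * xstep k) ^+ 2.
  by rewrite ler_pXn2r // nnegrE ?(le_trans (enorm_ge0 _) W) ?enorm_ge0.
have e4 := le_trans e3 (lerD (ler_wpM2l (ltW T0r) W2) (lexx _)).
have feasE : feas (residual k) (y k.+1) =
    feas (residual k) (y k) + enorm (y k.+1 - y k) ^+ 2 / (rho * r).
  by rewrite /feas dual_ascent; ring.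
have key : T0 / r * (lip_new * xstep k.+1 + lip_old * xstep k) ^+ 2
    + decrease * xstep k.+1 ^+ 2 + C1 / 2 * xstep k.+1 ^+ 2
    <= C_M / (2 * r) * xstep k.+1 ^+ 2 + C1 / 2 * xstep k ^+ 2.
  rewrite C1E C_ME /decrease; move: (xstep k) (xstep k.+1) => d0 d1.
  have -> : 2 * T0 * lip_old ^+ 2 / r = T0 / r * (2 * lip_old ^+ 2) by ring.
  have -> : (4 * lip_new ^+ 2 + 6 * lip_old ^+ 2) * T0 / (2 * r) =
    T0 / r * (2 * lip_new ^+ 2 + 3 * lip_old ^+ 2) by field; rewrite gt_eqF.
  move: (T0 / r) T0r => t /ltW t0; case: (eqVneq lip_old 0) => [->|_].
    by have := mulr_ge0 t0 (sqr_ge0 (lip_new * d1)); lra.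
  by have := mulr_ge0 t0 (sqr_ge0 (lip_new * d1 - lip_old * d0)); lra.
rewrite !energyE; move: e1 e2 e4 key; rewrite feasE; lra.
Qed.

Let cy : R := (Num.sqrt lam)^-1.
Let cy0 : 0 <= cy. Proof. by rewrite invr_ge0 sqrtr_ge0. Qed.
Let rhori0 : 0 <= (rho * r)^-1. Proof. by rewrite invr_ge0 ltW. Qed.
Let dx0 k : 0 <= xstep k. Proof. exact: enorm_ge0. Qed.
Let sy0 k : 0 <= ystep k. Proof. exact: enorm_ge0. Qed.

Lemma residual_le k : enorm (residual k) <= (rho * r)^-1 * cy * ystep k.
Proof.
rewrite residualE enormZ ger0_norm // -mulrA ler_wpM2l //.
exact: enorm_dy_le.
Qed.

(** [z k.+1] is [A *m x k.+1] up to the residual, which is a multiple of the dual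
step. *)
Lemma enorm_dz_le k : enorm (z k.+2 - z k.+1) <=
  (opnorm A + (rho * r)^-1 * cy) * (xstep k.+1 + ystep k.+1 + ystep k).
Proof.
have -> : z k.+2 - z k.+1 = A *m (x k.+2 - x k.+1) - (residual k.+1 - residual k).
  rewrite /residual mulmxBr; move: (A *m _) (A *m _) => a b.
  by apply/matrixP => i j; rewrite !mxE; ring.
apply: (le_trans (ler_enormB _ _)).
have a1 := enorm_mulmx_le A (x k.+2 - x k.+1).
have a2 := ler_enormB (residual k.+1) (residual k).
have a3 := residual_le k; have a4 := residual_le k.+1.
have p1 : 0 <= opnorm A * (ystep k.+1 + ystep k) by rewrite mulr_ge0 ?opnorm_ge0 ?addr_ge0.
have p2 : 0 <= (rho * r)^-1 * cy * xstep k.+1 by rewrite !mulr_ge0.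
rewrite -/(xstep k.+1) in a1; move: a1 a2 a3 a4 p1 p2.
move: (enorm _) (enorm _) (enorm _) (enorm _) ((rho * r)^-1 * cy) (opnorm A).
move: (xstep _) (ystep _) (ystep _).
by move=> *; lra.
Qed.

Lemma iterate_step : exists2 B : R, 0 <= B &
  forall k, enorm (iterate k.+1 - iterate k)
    <= B * (xstep k.+1 + ystep k.+1 + xstep k + ystep k).
Proof.
have [K K0 dzK] : exists2 K : R, 0 <= K &
    forall k, enorm (z k.+2 - z k.+1) <= K * (xstep k.+1 + ystep k.+1 + ystep k).
  exists (opnorm A + (rho * r)^-1 * cy); last exact: enorm_dz_le.
  by rewrite addr_ge0 ?opnorm_ge0 // mulr_ge0.
exists (2 + K + 2 * cy); first by apply: addr_ge0; [apply: addr_ge0|apply: mulr_ge0].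
move=> k; rewrite /iterate stackB; apply: (le_trans (enorm_stack_le _ _ _ _ _)).
have e1 := dzK k; have e2 := enorm_dy_le k; have e3 := enorm_dy_le k.+1.
rewrite -/(xstep k) -/(xstep k.+1).
have p1 := mulr_ge0 K0 (dx0 k).
have p2 := mulr_ge0 cy0 (dx0 k); have p3 := mulr_ge0 cy0 (dx0 k.+1).
have p4 := mulr_ge0 cy0 (sy0 k); have p5 := mulr_ge0 cy0 (sy0 k.+1).
move: e1 e2 e3 p1 p2 p3 p4 p5 (dx0 k) (dx0 k.+1) (sy0 k) (sy0 k.+1); rewrite -/cy.
lra.
Qed.

Let mu2 : R := sup (range (fun k => opnorm (M2 k))).
Lemma opnorm_M2_le k : opnorm (M2 k) <= mu2.
Proof. by case: HA => _ _ [_ M2b] _; apply: ub_le_sup => //; exists k. Qed.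
Let mu20 : 0 <= mu2. Proof. exact: le_trans (opnorm_ge0 _) (opnorm_M2_le 0). Qed.

Definition subgrad k :=
  reg_grad alg h A L r rho M1 (x k.+1) (z k.+1) (y k.+1) (x k) (y k) (zgrad k).

Lemma subgrad_frechet k : frechet_subdiff Psi (iterate k) (subgrad k).
Proof.
exact: (reg_lagrangian_frechet hdiff hlip r0 T1_ge0 C1_ge0 _ _ _ _ (gz_fin k) (z_prox k)).
Qed.

Lemma PsiE k : Psi (iterate k) = (energy k)%:E.
Proof. by rewrite /iterate Psi_stack -[g _]fineK ?gz_fin // -EFinD. Qed.

(** The optimality conditions of the three steps cancel everything in the blocks
of the subgradient except for terms that contain a difference of consecutive
iterates. *)
Lemma subgrad_le_steps k : enorm (subgrad k) <=
  (L + mu + 2 * C1 + r * opnorm A) * xstep k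
  + (1 + cy + (rho * r)^-1 * cy + 4 * T1 * opnorm A) * ystep k
  + mu2 * enorm (z k.+1 - z k).
Proof.
have A0 := opnorm_ge0 A; have t0 := T1_ge0; have c0 := C1_ge0.
rewrite /subgrad /reg_grad -/(residual k); apply: (le_trans (enorm_stack_le _ _ _ _ _)).
rewrite !enormN.
set g1 := enorm (_ + _ + C1 *: _).
have h1 : g1 <= (L + mu + C1) * xstep k + ystep k.
  have E : gradient h (x k.+1) + A^T *m y k.+1 + r *: (A^T *m residual k) + C1 *: (x k.+1 - x k)
    = (gradient h (x k.+1) - xgrad k) + A^T *m (y k.+1 - y k)
      + (C1 *: (x k.+1 - x k) - M1 k *m (x k.+1 - x k)).
    have -> : - xgrad k = A^T *m y k + r *: (A^T *m residual k) + M1 k *m (x k.+1 - x k).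
      by rewrite x_optimality /dual_target subrK.
    rewrite (mulmxBr A^T (y k.+1)); move: (gradient h (x k.+1)) (A^T *m y k.+1) (A^T *m y k).
    move: (A^T *m residual k) (x k.+1 - x k) (M1 k *m _) => a b c d e f.
    by apply/matrixP => i j; rewrite !mxE; ring.
  rewrite /g1 E; apply: (le_trans (ler_enormD _ _)).
  have q1 := ler_enormD (gradient h (x k.+1) - xgrad k) (A^T *m (y k.+1 - y k)).
  have q2 := ler_enormB (C1 *: (x k.+1 - x k)) (M1 k *m (x k.+1 - x k)).
  have q3 := enorm_M1_le k (x k.+1 - x k).
  have q4 : enorm (gradient h (x k.+1) - xgrad k) <= L * xstep k.
    rewrite /xgrad; case: alg; last exact: hlip.
    by rewrite subrr enorm0 mulr_ge0 // ltW // L_gt0.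
  rewrite enormZ (ger0_norm c0) in q2; rewrite -/(xstep k) in q2 q3; rewrite -/(ystep k) in q1.
  lra.
have h2 : enorm (zgrad k - y k.+1 - r *: residual k) <= cy * ystep k + r * opnorm A * xstep k
    + mu2 * enorm (z k.+1 - z k).
  have -> : zgrad k - y k.+1 - r *: residual k =
     - (y k.+1 - y k) - r *: (A *m (x k.+1 - x k)) - M2 k *m (z k.+1 - z k).
    rewrite /zgrad /residual (mulmxBr A); move: (A *m _) (A *m _) (M2 k *m _) => a b c.
    by apply/matrixP => i j; rewrite !mxE; ring.
  apply: (le_trans (ler_enormB _ _)).
  have q1 := ler_enormB (- (y k.+1 - y k)) (r *: (A *m (x k.+1 - x k))).
  rewrite enormN enormZ (gtr0_norm r0) in q1; have q2 := enorm_dy_le k.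
  have q3 := ler_wpM2l (ltW r0) (enorm_mulmx_le A (x k.+1 - x k)).
  have q4 := le_trans (enorm_mulmx_le (M2 k) (z k.+1 - z k))
     (ler_wpM2r (enorm_ge0 _) (opnorm_M2_le k)).
  rewrite -/(xstep k) in q3; rewrite -/cy in q2; lra.
have h4 : enorm ((2 * T1) *: (A *m (A^T *m (y k.+1 - y k)))) <= 2 * T1 * opnorm A * ystep k.
  rewrite enormZ ger0_norm; last by rewrite mulr_ge0.
  by rewrite -[leRHS]mulrA ler_wpM2l ?mulr_ge0 // enorm_mulmx_le.
have h3 := ler_enormD (residual k) ((2 * T1) *: (A *m (A^T *m (y k.+1 - y k)))).
have h5 := residual_le k.
have h6 : enorm (C1 *: (x k.+1 - x k)) = C1 * xstep k by rewrite enormZ ger0_norm.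
rewrite h6 -/(ystep k) in h3 h4 *; move: h1 h2 h3 h4 h5; lra.
Qed.

Lemma subgrad_le : exists2 b : R, 0 <= b &
  forall k, enorm (subgrad k.+1) <= b * (xstep k.+1 + ystep k.+1 + ystep k).
Proof.
pose a1 := L + mu + 2 * C1 + r * opnorm A.
pose a2 := 1 + cy + (rho * r)^-1 * cy + 4 * T1 * opnorm A.
pose a3 := mu2 * (opnorm A + (rho * r)^-1 * cy).
have A0 := opnorm_ge0 A; have t0 := T1_ge0; have c0 := C1_ge0; have l0 := L_gt0.
have m0 := mu_ge0; have q0 : 0 <= (rho * r)^-1 * cy by rewrite mulr_ge0.
have a10 : 0 <= a1 by rewrite /a1; have := mulr_ge0 (ltW r0) A0; lra.
have a20 : 0 <= a2 by rewrite /a2; have := mulr_ge0 t0 A0; have := cy0; lra.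
have a30 : 0 <= a3 by rewrite mulr_ge0 // addr_ge0.
exists (a1 + a2 + a3); first by apply: addr_ge0 => //; apply: addr_ge0.
move=> k; apply: (le_trans (subgrad_le_steps k.+1)); rewrite -/a1 -/a2.
have h3 := ler_wpM2l mu20 (enorm_dz_le k); rewrite mulrA -/a3 in h3.
have := mulr_ge0 a10 (sy0 k); have := mulr_ge0 a10 (sy0 k.+1).
have := mulr_ge0 a20 (sy0 k); have := mulr_ge0 a20 (dx0 k.+1).
move: (mu2 * _) h3 => t h3.
move: a1 a2 a3 h3 {a10 a20 a30} => a1 a2 a3; lra.
Qed.

End Iterates.

(** * Limit points of bounded iterates *)

Section BoundedIterates.
Context {R : realType} {n m : nat} (alg : algorithm).
Context (g : 'cV[R]_m -> \bar R) (h : 'cV[R]_n -> R) (A : 'M[R]_(m, n)).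
Context (L r rho : R) (M1 : nat -> 'M[R]_n) (M2 : nat -> 'M[R]_m).
Context (x : nat -> 'cV[R]_n) (z y : nat -> 'cV[R]_m).
Context (Hset : setting g h L r rho M1 M2).
Context (HA : assumption_A alg g h A L r rho M1 M2).
Context (Hgen : generated alg g h A r rho M1 M2 x z y).
Context (Hbd : bounded_fun (fun k => (x k, z k, y k))).

Local Notation Psi := (reg_aug_lagrangian_stacked alg g h A L r rho M1).
Local Notation en := (energy alg g h A L r rho M1 x z y).
Local Notation xs := (xstep x).
Local Notation ys := (ystep A y).
Local Notation wk := (iterate x z y).
Local Notation rk := (residual A x z).
Local Notation zg := (zgrad A r M2 x z y).
Local Notation sg := (subgrad alg h A L r rho M1 M2 x z y).

Let r0 : 0 < r. Proof. by case: Hset => _ _ _ []. Qed.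
Let rho0 : 0 < rho. Proof. by case: Hset => _ _ _ [_ /andP[]]. Qed.
Let rho2 : rho < 2. Proof. by case: Hset => _ _ _ [_ /andP[]]. Qed.
Let hdiff w : differentiable h w. Proof. by case: Hset => _ []. Qed.
Let hlip w w' : enorm (gradient h w - gradient h w') <= L * enorm (w - w').
Proof. by case: Hset => _ []. Qed.

Lemma bounded_iterates : exists b : R, forall k,
  [/\ enorm (x k) <= b, enorm (z k) <= b & enorm (y k) <= b].
Proof.
case: Hbd => M [_ /(_ (M + 1))]; rewrite ltrDl ltr01 => /(_ isT) HM.
exists ((n + m)%:R * (M + 1)) => k.
have := HM k I; rewrite /= !prod_normE /= !ge_max => /andP[/andP[bx bz] byy].
have en_le p (u : 'cV[R]_p) : (p <= n + m)%N -> `|u| <= M + 1 ->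
    enorm u <= (n + m)%:R * (M + 1).
  move=> pn uM; apply: (le_trans (enorm_le_mx_norm u)).
  by apply: ler_pM => //; rewrite ler_nat.
by split; apply: en_le => //; rewrite ?leq_addr ?leq_addl.
Qed.

Lemma energy_lower_bound : exists lb : R, forall k, lb <= en k.
Proof.
have [b bP] := bounded_iterates; case: HA => [[[bg gb] [bh hb]] _ _ _].
have b0 : 0 <= b by have [h1 _ _] := bP 0%N; apply: le_trans h1; exact: enorm_ge0.
exists (bg + bh - b * (opnorm A * b + b)) => k; rewrite /energy /reg_real.
have [_ _ yb] := bP k.+1; have [xb zb _] := bP k.+1.
have e1 : bg <= fine (g (z k.+1)).
  by rewrite -lee_fin fineK ?gb // (gz_fin Hset Hgen).
have e2 := hb (x k.+1).
have e3 := normr_inner_le (y k.+1) (A *m x k.+1 - z k.+1).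
have e4 : enorm (A *m x k.+1 - z k.+1) <= opnorm A * b + b.
  apply: (le_trans (ler_enormB _ _)); apply: lerD => //.
  by apply: (le_trans (enorm_mulmx_le _ _)); rewrite ler_wpM2l ?opnorm_ge0.
have e5 : enorm (y k.+1) * enorm (A *m x k.+1 - z k.+1) <= b * (opnorm A * b + b).
  by apply: ler_pM => //; exact: enorm_ge0.
have e6 : 0 <= r / 2 * enorm (A *m x k.+1 - z k.+1) ^+ 2.
  by rewrite mulr_ge0 ?sqr_ge0 // divr_ge0 // ltW.
have e7 : 0 <= T1 A r rho * enorm (A^T *m (y k.+1 - y k)) ^+ 2.
  by rewrite mulr_ge0 ?sqr_ge0 // (T1_ge0 Hset HA).
have e8 : 0 <= C1 alg A L r rho M1 / 2 * enorm (x k.+1 - x k) ^+ 2.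
  by rewrite mulr_ge0 ?sqr_ge0 // divr_ge0 // (C1_ge0 Hset HA).
have e9 := ler_norm (- inner (y k.+1) (A *m x k.+1 - z k.+1)); rewrite normrN in e9.
by move: e1 e2 e3 e5 e6 e7 e8 e9; lra.
Qed.

Let c0 := decrease_gt0 Hset HA.

Let en_nonincr : {homo en : k l / (k <= l)%N >-> l <= k}.
Proof.
apply/nonincreasing_seqP => k; have := energy_decrease Hset HA Hgen k.
by have := mulr_ge0 (ltW c0) (sqr_ge0 (xs k.+1)); lra.
Qed.

Lemma energy_cvg : exists Fs : R, (forall k, Fs <= en k) /\ en @ \oo --> Fs.
Proof.
have [lb lbP] := energy_lower_bound.
have hlb : has_lbound (range en) by exists lb => _ [k _ <-].
exists (inf (range en)); split; last exact: nonincreasing_cvgn.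
by move=> k; apply: ge_inf => //; exists k.
Qed.

Lemma xstep_cvg0 : xs @ \oo --> (0 : R).
Proof.
have [lb lbP] := energy_lower_bound; pose c := decrease alg A L r rho M1; have cp : 0 < c := c0.
rewrite -(cvg_shiftS xs); apply: cvg0_sqr.
apply: (@cvg0_summable _ _ ((en 0 - lb) / c)) => [k|j]; first exact: sqr_ge0.
rewrite ler_pdivlMr //.
suff : (\sum_(0 <= k < j) xs k.+1 ^+ 2) * c <= en 0 - en j by have := lbP j; lra.
elim: j => [|j IH]; first by rewrite big_geq // mul0r subrr.
rewrite big_nat_recr //= mulrDl.
by have := energy_decrease Hset HA Hgen j; rewrite -/c; lra.
Qed.

Lemma ystep_cvg0 : ys @ \oo --> (0 : R).
Proof.
apply: (@cvg0_contraction _ ys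
  (fun k => rho * (lip_new alg L M1 + lip_old alg L M1) * (xs k.+1 + xs k)) `|1 - rho|).
- exact: normr_ge0.
- by rewrite ltr_norml; apply/andP; split; move: rho0 rho2; lra.
- by move=> k; exact: enorm_ge0.
- exact: ystep_rec Hset HA Hgen.
rewrite -(mulr0 (rho * (lip_new alg L M1 + lip_old alg L M1))).
apply: cvgM; first exact: cvg_cst.
rewrite -[X in _ --> X](addr0 (0 : R)); apply: cvgD; last exact: xstep_cvg0.
by rewrite (cvg_shiftS xs); exact: xstep_cvg0.
Qed.

Lemma dy_cvg0 : (fun k => y k.+1 - y k) @ \oo --> (0 : 'cV[R]_m).
Proof.
apply: (@cvg_enorm_le _ _ _ _ (fun k => (Num.sqrt (lamA A))^-1 * ys k)).
  by move=> k; rewrite subr0; exact: enorm_dy_le HA _.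
rewrite -(mulr0 (Num.sqrt (lamA A))^-1).
by apply: cvgM; [exact: cvg_cst|exact: ystep_cvg0].
Qed.

Lemma residual_cvg0 : rk @ \oo --> (0 : 'cV[R]_m).
Proof.
apply: (@cvg_enorm_le _ _ _ _ (fun k => (rho * r)^-1 * (Num.sqrt (lamA A))^-1 * ys k)).
  by move=> k; rewrite subr0; exact: residual_le Hset HA Hgen _.
rewrite -(mulr0 ((rho * r)^-1 * (Num.sqrt (lamA A))^-1)).
by apply: cvgM; [exact: cvg_cst|exact: ystep_cvg0].
Qed.

Lemma subgrad_cvg0 : (fun k => sg k.+1) @ \oo --> (0 : 'cV[R]_(n + (m + (m + (n + m))))).
Proof.
have [b b0 sb] := subgrad_le Hset HA Hgen.
apply: (@cvg_enorm_le _ _ _ _ (fun k => b * (xs k.+1 + ys k.+1 + ys k))).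
  by move=> k; rewrite subr0; exact: sb.
rewrite -(mulr0 b); apply: cvgM; first exact: cvg_cst.
rewrite (_ : (0 : R) = 0 + 0 + 0); last by rewrite !addr0.
apply: cvgD; last exact: ystep_cvg0.
by apply: cvgD; [rewrite (cvg_shiftS xs); exact: xstep_cvg0
                |rewrite (cvg_shiftS ys); exact: ystep_cvg0].
Qed.

Lemma lsc_value_limit (u : 'cV[R]_m) (us : nat -> 'cV[R]_m) (G : R) :
  us @ \oo --> u -> (forall j, g (us j) \is a fin_num) ->
  (fun j => fine (g (us j))) @ \oo --> G -> (g u <= G%:E)%E.
Proof.
move=> usu gfin gG; rewrite leNgt; apply/negP => Gg.
have [a Ga ag] : exists2 a : R, G < a & (a%:E < g u)%E.
  case: (g u) Gg => [b| _|//].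
    rewrite lte_fin => Gb; exists ((G + b) / 2); rewrite ?lte_fin; lra.
  by exists (G + 1); rewrite ?ltrDl ?ltry.
have [V uV Va] : exists2 V : set 'cV[R]_m, nbhs u V & forall w, V w -> (a%:E < g w)%E.
  by case: Hset => [[_ lsc] _ _ _]; exact: lsc ag.
have : a <= G.
  apply: (ler_cvg_to (cvg_cst a) gG).
  have : \forall j \near \oo, V (us j) by exact: usu uV.
  by apply: filterS => j /Va; rewrite -[g _]fineK // lte_fin => /ltW.
by rewrite leNgt Ga.
Qed.

Lemma gradient_cvg (us : nat -> 'cV[R]_n) (a : 'cV[R]_n) :
  us @ \oo --> a -> (fun j => gradient h (us j)) @ \oo --> gradient h a.
Proof.
move=> ua; apply: (@cvg_enorm_le _ _ _ _ (fun j => L * enorm (us j - a))) => //.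
rewrite -(mulr0 L); apply: cvgM; first exact: cvg_cst.
exact/cvg_enorm0P.
Qed.

Lemma M1_xstep_cvg0 : (fun k => M1 k *m (x k.+1 - x k)) @ \oo --> (0 : 'cV[R]_n).
Proof.
apply: (@cvg_enorm_le _ _ _ _ (fun k => mu1 M1 * xs k)).
  by move=> k; rewrite subr0; exact: enorm_M1_le HA _ _.
by rewrite -(mulr0 (mu1 M1)); apply: cvgM; [exact: cvg_cst|exact: xstep_cvg0].
Qed.

(** The values of [g] along the subsequence have a limit [G], because those of the
energy and of the continuous part do.  Lower semicontinuity gives [g zh <= G];
conversely [z_prox], tested at [zh], bounds [g zh] from below by quantities that
tend to [G].  Closedness of the limiting subdifferential then requires only
convergence of the subgradients: the subgradient of the energy tends to 0, and
its [z]-block shows that [zgrad] tends to [yh]. *)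
Lemma cluster_critical (u : 'cV[R]_(n + (m + (m + (n + m))))) (Fs : R) :
  (forall (e : R) K, 0 < e -> exists2 k, (K <= k)%N & enorm (wk k - u) < e) ->
  en @ \oo --> Fs ->
  [/\ KKT g h A (usubmx u) (usubmx (dsubmx u)) (usubmx (dsubmx (dsubmx u))),
      limiting_subdiff Psi u 0 & Psi u = Fs%:E].
Proof.
move=> clu enF.
(* the index [(l j).+1] rather than [l j], as [subgrad_cvg0] starts at index 1 *)
have /choice[l lP] : forall j, exists l, (j <= l)%N /\ enorm (wk l.+1 - u) < j.+1%:R^-1.
  move=> j; have j0 : 0 < j.+1%:R^-1 :> R by rewrite invr_gt0.
  have [[//|k] jk ku] := clu _ j.+1 j0.
  by exists k.
have lj j : (j <= l j)%N by case: (lP j).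
have ljS j : (j <= (l j).+1)%N by rewrite leqW.
have wu : (fun j => wk (l j).+1) @ \oo --> u.
  apply: (@cvg_enorm_le _ _ _ _ (fun j => j.+1%:R^-1)) cvg_harmonic.
  by move=> j; have [_ /ltW] := lP j.
set xh := usubmx u; set zh := usubmx (dsubmx u); set yh := usubmx (dsubmx (dsubmx u)).
pose xh' := usubmx (dsubmx (dsubmx (dsubmx u))).
pose yh' := dsubmx (dsubmx (dsubmx (dsubmx u))).
have xc : (fun j => x (l j).+2) @ \oo --> xh.
  by have := cvg_usubmx wu; under eq_fun do rewrite col_mxKu.
have wu1 := cvg_dsubmx wu.
have zc : (fun j => z (l j).+2) @ \oo --> zh.
  by have := cvg_usubmx wu1; under eq_fun do rewrite col_mxKd col_mxKu.
have wu2 := cvg_dsubmx wu1.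
have yc : (fun j => y (l j).+2) @ \oo --> yh.
  by have := cvg_usubmx wu2; under eq_fun do rewrite !col_mxKd col_mxKu.
have wu3 := cvg_dsubmx wu2.
have xc' : (fun j => x (l j).+1) @ \oo --> xh'.
  by have := cvg_usubmx wu3; under eq_fun do rewrite !col_mxKd col_mxKu.
have yc' : (fun j => y (l j).+1) @ \oo --> yh'.
  by have := cvg_dsubmx wu3; under eq_fun do rewrite !col_mxKd.
have dxc : (fun j => x (l j).+2 - x (l j).+1) @ \oo --> (0 : 'cV[R]_n).
  apply: (@cvg_enorm_le _ _ _ _ (xs \o (fun j => (l j).+1))).
    by move=> j; rewrite subr0.
  exact: cvg_subseq ljS xstep_cvg0.
have dyc : (fun j => y (l j).+2 - y (l j).+1) @ \oo --> (0 : 'cV[R]_m).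
  exact: cvg_subseq ljS dy_cvg0.
have rc : (fun j => rk (l j).+1) @ \oo --> (0 : 'cV[R]_m).
  exact: cvg_subseq ljS residual_cvg0.
have sgc : (fun j => sg (l j).+1) @ \oo --> (0 : 'cV[R]_(n + (m + (m + (n + m))))).
  exact: cvg_subseq lj subgrad_cvg0.
have xhE : xh' = xh.
  apply: cvg_vec_unique xc' _.
  exact: cvg_vanishing_diff xc dxc.
have yhE : yh' = yh.
  apply: cvg_vec_unique yc' _.
  exact: cvg_vanishing_diff yc dyc.
have rc' : (fun j => A *m x (l j).+2 - z (l j).+2) @ \oo --> A *m xh - zh.
  exact: cvg_vecB (cvg_mulmx (M := A) xc) zc.
have zhE : zh = A *m xh.
  apply/eqP; rewrite eq_sym -subr_eq0; apply/eqP.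
  exact: cvg_vec_unique rc' rc.
have regc : (fun j => reg_real alg h A L r rho M1 (x (l j).+2) (z (l j).+2) (y (l j).+2)
     (x (l j).+1) (y (l j).+1)) @ \oo --> reg_real alg h A L r rho M1 xh zh yh xh' yh'.
  rewrite /reg_real.
  have hc : (fun j => h (x (l j).+2)) @ \oo --> h xh.
    exact: (continuous_cvg _ (differentiable_continuous (hdiff xh)) xc).
  have sq N (vs : nat -> 'cV[R]_N) v : vs @ \oo --> v ->
      (fun j => enorm (vs j) ^+ 2) @ \oo --> enorm v ^+ 2.
    by move=> vv; rewrite enorm_sqr; under eq_fun do rewrite enorm_sqr; exact: cvg_inner.
  apply: cvgD; apply: cvgD.
  - by apply: cvgD => //; exact: cvg_inner.
  - by apply: cvgM; [exact: cvg_cst|exact: sq].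
  - apply: cvgM; first exact: cvg_cst.
    by apply: sq; apply: cvg_mulmx; exact: cvg_vecB yc yc'.
  - apply: cvgM; first exact: cvg_cst.
    by apply: sq; exact: cvg_vecB xc xc'.
have enc : (fun j => en (l j).+1) @ \oo --> Fs := cvg_subseq ljS enF.
pose G := Fs - reg_real alg h A L r rho M1 xh zh yh xh' yh'.
have gc : (fun j => fine (g (z (l j).+2))) @ \oo --> G.
  rewrite (_ : (fun j => fine _) = (fun j => en (l j).+1) - (fun j => reg_real alg h A L r rho
    M1 (x (l j).+2) (z (l j).+2) (y (l j).+2) (x (l j).+1) (y (l j).+1))); last first.
    by apply/funext => j; rewrite !fctE /energy addrK.
  exact: cvgB enc regc.
have zgc : (fun j => zg (l j).+1) @ \oo --> yh.
  have rsc : (fun j => r *: rk (l j).+1) @ \oo --> (0 : 'cV[R]_m).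
    by rewrite -(scaler0 _ r); exact: cvg_vecZ.
  have c1 := cvg_usubmx (cvg_dsubmx sgc).
  have -> : (fun j => zg (l j).+1) = (fun j => usubmx (dsubmx (sg (l j).+1))
      + y (l j).+2 + r *: rk (l j).+1).
    apply/funext => j; rewrite /subgrad /reg_grad /stack col_mxKd col_mxKu.
    by rewrite -/(residual A x z (l j).+1) [RHS]addrAC subrK subrK.
  have := cvg_vecD (cvg_vecD c1 yc) rsc.
  by rewrite !linear0 add0r addr0.
have gle : (g zh <= G%:E)%E.
  exact: lsc_value_limit zc (fun j => gz_fin Hset Hgen (l j).+1) gc.
have gfin : g zh \is a fin_num.
  rewrite fin_numE; apply/andP; split; first by case: Hset => [[[-> _] _] _ _ _].
  by rewrite lt_eqF // (le_lt_trans gle) // ltry.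
have gE : g zh = G%:E.
  pose Cu := r / 2 + sup (range (fun k => opnorm (M2 k))) / 2.
  have dz0 : (fun j => zh - z (l j).+2) @ \oo --> zh - zh.
    by apply: cvg_vecB zc; exact: cvg_cst.
  have lowc : (fun j => fine (g (z (l j).+2)) + (inner (zg (l j).+1) (zh - z (l j).+2)
      - Cu * inner (zh - z (l j).+2) (zh - z (l j).+2))) @ \oo --> G.
    rewrite -[X in _ --> X]addr0; apply: cvgD => //.
    have -> : (0 : R) = inner yh (zh - zh) - Cu * inner (zh - zh) (zh - zh).
      by rewrite (subrr zh) !inner0r mulr0 subr0.
    apply: cvgB; first exact: cvg_inner.
    by apply: cvgM; [exact: cvg_cst|exact: cvg_inner].
  apply/eqP; rewrite eq_le gle /= -(fineK gfin) lee_fin.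
  apply: (ler_cvg_to lowc (cvg_cst (fine (g zh)))).
  apply: nearW => j; rewrite -lee_fin fineK // EFinD fineK ?(gz_fin Hset Hgen) //.
  have := z_prox Hset Hgen (l j).+1 (zh - z (l j).+2).
  rewrite (addrC (z (l j).+2)) subrK.
  apply: le_trans; rewrite leeD2l // lee_fin lerD2l lerN2 -enorm_sqr.
  by rewrite ler_wpM2r ?sqr_ge0 // lerD2l ler_wpM2r // (opnorm_M2_le HA).
have frz j : frechet_subdiff g (z (l j).+2) (zg (l j).+1).
  apply: proximal_frechet_subdiff; first exact: gz_fin Hset Hgen _.
  move=> v; have := z_prox Hset Hgen (l j).+1 (v - z (l j).+2).
  by rewrite (addrC (z _)) subrK; exact.
have gradE : - (A^T *m yh) = gradient h xh.
  have gc' : (fun j => xgrad alg h x (l j).+1) @ \oo --> gradient h xh.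
    rewrite /xgrad; case: (alg); first exact: gradient_cvg xc.
    by rewrite -xhE; exact: gradient_cvg xc'.
  have lim1 := cvg_vecD (cvg_mulmx (M := A^T) yc') (cvg_vecZ (c := r) (cvg_mulmx (M := A^T) rc)).
  have lim2 := cvg_vecB (cvg_vecB (cvg_cst (0 : 'cV[R]_n)) gc') (cvg_subseq ljS M1_xstep_cvg0).
  have E : A^T *m yh' + r *: (A^T *m 0) = 0 - gradient h xh - 0.
    apply: cvg_vec_unique lim1 _.
    rewrite (_ : (fun j => _) = (fun j => 0 - xgrad alg h x (l j).+1
      - M1 (l j).+1 *m (x (l j).+2 - x (l j).+1))); first exact: lim2.
    by apply/funext => j; rewrite (x_optimality Hset HA Hgen) /dual_target sub0r.
  by move: E; rewrite yhE mulmx0 scaler0 addr0 subr0 sub0r => ->; rewrite opprK.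
have PsiuE : Psi u = Fs%:E.
  by rewrite (stackK u) Psi_stack gE -EFinD /G subrK.
split => //.
- split => //; split=> //; exists (fun j => z (l j).+2), (fun j => zg (l j).+1).
  split => //; rewrite gE; apply: cvg_EFin gc.
  by apply: nearW => j; exact: gz_fin Hset Hgen _.
- split; first by rewrite PsiuE.
  exists (fun j => wk (l j).+1), (fun j => sg (l j).+1); split => //; last first.
    by move=> j; exact: subgrad_frechet Hset HA Hgen _.
  rewrite PsiuE (_ : Psi \o _ = (fun j => (en (l j).+1)%:E)); last first.
    by apply/funext => j /=; rewrite (PsiE Hset Hgen).
  by apply: cvg_EFin enc; exact: nearW.
Qed.

End BoundedIterates.

(** * Convergence of the proximal ADMM *)

Theorem theorem14 (R : realType) (n m : nat) (alg : algorithm)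
    (g : 'cV[R]_m -> \bar R) (h : 'cV[R]_n -> R) (A : 'M[R]_(m, n))
    (L r rho : R) (M1 : nat -> 'M[R]_n) (M2 : nat -> 'M[R]_m)
    (x : nat -> 'cV[R]_n) (z y : nat -> 'cV[R]_m) :
  setting g h L r rho M1 M2 ->
  assumption_A alg g h A L r rho M1 M2 ->
  generated alg g h A r rho M1 M2 x z y ->
  bounded_fun (fun k => (x k, z k, y k)) ->
  KL_function (reg_aug_lagrangian_stacked alg g h A L r rho M1) ->
  [/\ (\sum_(0 <= k <oo) (enorm (x k.+1 - x k))%:E < +oo)%E,
      (\sum_(0 <= k <oo) (enorm (z k.+1 - z k))%:E < +oo)%E
    & (\sum_(0 <= k <oo) (enorm (y k.+1 - y k))%:E < +oo)%E]
  /\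
  (exists (xh : 'cV[R]_n) (zh yh : 'cV[R]_m),
     KKT g h A xh zh yh /\
     (fun k => (x k, z k, y k)) @ \oo --> (xh, zh, yh)).
Proof.
move=> Hset HA Hgen Hbd HKL.
have [b bP] := bounded_iterates Hbd.
have wb k : enorm (iterate x z y k) <= b + b + b + b + b.
  have [xb zb yb] := bP k.+1; have [xb' _ yb'] := bP k.
  by apply: (le_trans (enorm_stack_le _ _ _ _ _)); rewrite !lerD.
have [u clu] := bounded_seq_cluster wb.
have [Fs [FsE EF]] := energy_cvg Hset HA Hgen Hbd.
have [kkt critu PsiuE] := cluster_critical Hset HA Hgen Hbd clu EF.
have [bs bs0 subb] := subgrad_le Hset HA Hgen.
have [B B0 stepB] := iterate_step Hset HA Hgen.
have [r0 rho0 rho2] : [/\ 0 < r, 0 < rho & rho < 2] by case: Hset => _ _ _ [? /andP[]].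
have th : 0 <= `|1 - rho| < 1.
  by rewrite normr_ge0 ltr_norml; move: rho0 rho2; clear => *; apply/andP; split; lra.
have p0 : 0 <= rho * (lip_new alg L M1 + lip_old alg L M1).
  by rewrite mulr_ge0 ?(ltW rho0) // ltW // (lip_sum_gt0 Hset HA).
have dx0 k : 0 <= xstep x k := enorm_ge0 _.
have sy0 k : 0 <= ystep A y k := enorm_ge0 _.
have [wu [M HM]] := KL_finite_length (decrease_gt0 Hset HA) bs0 th p0 B0 dx0 sy0
  (PsiE Hset Hgen) PsiuE (energy_decrease Hset HA Hgen)
  (fun k => ex_intro2 _ _ _ (subgrad_frechet Hset HA Hgen k.+1) (subb k))
  (ystep_rec Hset HA Hgen) stepB FsE EF (xstep_cvg0 Hset HA Hgen Hbd) (ystep_cvg0 Hset HA Hgen Hbd)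
  clu (HKL u (ex_intro _ _ critu)).
have Hd j : \sum_(0 <= k < j) xstep x k <= M.
  by apply: le_trans (HM j); apply: ler_sum => k _; rewrite lerDl.
have Hs j : \sum_(0 <= k < j) ystep A y k <= M.
  by apply: le_trans (HM j); apply: ler_sum => k _; rewrite lerDr.
split; first split.
- by apply: (nneseries_lt_pinfty _ Hd) => k; exact: enorm_ge0.
- pose K := opnorm A + (rho * r)^-1 * (Num.sqrt (lamA A))^-1.
  have K0 : 0 <= K.
    by rewrite addr_ge0 ?opnorm_ge0 // mulr_ge0 // invr_ge0 ?sqrtr_ge0 // ltW // mulr_gt0.
  have tail (f : nat -> R) j : (forall k, 0 <= f k) ->
      \sum_(0 <= k < j) f k.+1 <= \sum_(0 <= k < j.+1) f k.
    by move=> f0; rewrite big_nat_recl // lerDr.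
  apply: (@nneseries_lt_pinfty _ _ (enorm (z 1 - z 0) + K * (M + M + M))) => [k|j].
    exact: enorm_ge0.
  apply: (@le_trans _ _ (\sum_(0 <= k < j.+1) enorm (z k.+1 - z k))).
    by rewrite big_nat_recr //= lerDl enorm_ge0.
  rewrite big_nat_recl // lerD2l.
  apply: (@le_trans _ _ (\sum_(0 <= k < j) K * (xstep x k.+1 + ystep A y k.+1 + ystep A y k))).
    by apply: ler_sum => k _; exact: enorm_dz_le Hset HA Hgen _.
  rewrite -mulr_sumr ler_wpM2l // !big_split /= !lerD //.
    exact: le_trans (tail _ _ dx0) (Hd _).
  exact: le_trans (tail _ _ sy0) (Hs _).
- apply: (@nneseries_lt_pinfty _ _ ((Num.sqrt (lamA A))^-1 * M)) => [k|j].
    exact: enorm_ge0.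
  apply: (@le_trans _ _ (\sum_(0 <= k < j) (Num.sqrt (lamA A))^-1 * ystep A y k)).
    by apply: ler_sum => k _; exact: enorm_dy_le HA _.
  by rewrite -mulr_sumr ler_wpM2l // invr_ge0 sqrtr_ge0.
exists (usubmx u), (usubmx (dsubmx u)), (usubmx (dsubmx (dsubmx u))); split=> //.
have wu1 := cvg_dsubmx wu.
have xc : x @ \oo --> usubmx u.
  have : (fun k => x k.+1) @ \oo --> usubmx u.
    by have := cvg_usubmx wu; under eq_fun do rewrite col_mxKu.
  by rewrite (cvg_shiftS x).
have zc : z @ \oo --> usubmx (dsubmx u).
  have : (fun k => z k.+1) @ \oo --> usubmx (dsubmx u).
    by have := cvg_usubmx wu1; under eq_fun do rewrite col_mxKd col_mxKu.
  by rewrite (cvg_shiftS z).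
have yc : y @ \oo --> usubmx (dsubmx (dsubmx u)).
  have : (fun k => y k.+1) @ \oo --> usubmx (dsubmx (dsubmx u)).
    by have := cvg_usubmx (cvg_dsubmx wu1); under eq_fun do rewrite !col_mxKd col_mxKu.
  by rewrite (cvg_shiftS y).
exact: (cvg_pair (cvg_pair xc zc) yc).
Qed.
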